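(* Let $f\in\mathbb{H}^2(\mathbb{D})$ and let $n$ be a positive integer. If $f$ is not identical with an $m$-Blaschke form for any $m<n$, then there exists a non-degenerate $n$-best approximation to $f$; that is, there exist $a_1,\dots,a_n\in\mathbb{D}$ (multiplicity allowed) such that $$\Big\|f-\sum_{k=1}^n\langle f,E_{a_1,\dots,a_k}\rangle E_{a_1,\dots,a_k}\Big\|=\inf\Big\{\Big\|f-\sum_{k=1}^n\langle f,E_{b_1,\dots,b_k}\rangle E_{b_1,\dots,b_k}\Big\| : b_1,\dots,b_n\in\mathbb{D}\Big\}$$ and the $n$-Blaschke form $\sum_{k=1}^n\langle f,E_{a_1,\dots,a_k}\rangle E_{a_1,\dots,a_k}$ is non-degenerate, i.e. $\langle f,E_{a_1,\dots,a_n}\rangle\neq 0$.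
   Context: $\mathbb{D}$ is the open unit disc in $\mathbb{C}$. The Hardy space is $$\mathbb{H}^2(\mathbb{D})=\Big\{f:\mathbb{D}\to\mathbb{C} : f(z)=\sum_{k=0}^\infty c_kz^k,\ \sum_{k=0}^\infty|c_k|^2<\infty\Big\},$$ with inner product $\langle f,g\rangle=\frac{1}{2\pi}\int_0^{2\pi}f(e^{it})\overline{g(e^{it})}\,dt$ defined through non-tangential boundary limits, and $\|\cdot\|$ is the associated norm. For $a\in\mathbb{D}$ the normalized Szegő kernel is $e_a(z)=\frac{\sqrt{1-|a|^2}}{1-\bar a z}$. For a finite sequence $a_1,\dots,a_k\in\mathbb{D}$ (repetitions allowed) the Takenaka–Malmquist function is $$E_{a_1,\dots,a_k}(z)=\frac{\sqrt{1-|a_k|^2}}{1-\bar a_k z}\prod_{j=1}^{k-1}\frac{z-a_j}{1-\bar a_j z},$$ with the empty product equal to $1$, so $E_{a_1}=e_{a_1}$. For any $a_1,\dots,a_n\in\mathbb{D}$ the functions $E_{a_1},E_{a_1,a_2},\dots,E_{a_1,\dots,a_n}$ form an orthonormal system in $\mathbb{H}^2(\mathbb{D})$. An $m$-Blaschke form is a function of the form $\sum_{k=1}^m c_kE_{a_1,\dots,a_k}$ with $a_1,\dots,a_m\in\mathbb{D}$ and $c_1,\dots,c_m\in\mathbb{C}$; the $0$-Blaschke form is the zero function (empty sum). An $m$-Blaschke form ($m\ge1$) so written is non-degenerate if $c_m\neq0$. *)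

(* Defs.v *)
From HB Require Import structures.
From mathcomp Require Import all_boot all_order all_algebra.
From mathcomp Require Import complex.
From mathcomp Require Import all_classical all_reals all_analysis.

Set Implicit Arguments.
Unset Strict Implicit.
Unset Printing Implicit Defensive.

Import Order.TTheory GRing.Theory Num.Theory.
Import numFieldNormedType.Exports.

Local Open Scope classical_set_scope.
Local Open Scope ring_scope.

(* The topology of the numFieldType R[i], made canonical on the type R[i].    *)
HB.instance Definition _ (R : realType) :=
  NormedModule.copy R[i] (R[i] : numFieldType).

Section HardySpace.
Context {R : realType}.
Local Notation C := R[i].

(* The modulus as an element of R; the generic `|z| lives in R[i].            *)
Definition cmod (z : C) : R := complex.ComplexField.Normc.normc z.

Definition unit_disc : set C := [set z | cmod z < 1].

(* Functions on the disc are represented by total functions C -> C of which   *)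
(* only the values on unit_disc are ever used.                                *)
Definition hardy2 (f : C -> C) : Prop :=
  exists c : nat -> C,
    cvgn (series (fun k => cmod (c k) ^+ 2)) /\
    (forall z, unit_disc z -> [series c k * z ^+ k]_k @ \oo --> f z).

Definition stolz (M : R) (w : C) : set C :=
  [set z | unit_disc z /\ cmod (w - z) < M * (1 - cmod z)].

(* Only meant for w on the unit circle. *)
Definition nontangential_limit (f : C -> C) (w l : C) : Prop :=
  forall M : R, 1 < M -> f z @[z --> within (stolz M w) (nbhs w)] --> l.

(* f(e^{it}), with the arbitrary value 0 where the limit does not exist. *)
Definition boundary_value (f : C -> C) (t : R) : C :=
  xget 0 [set l | nontangential_limit f (Complex (cos t) (sin t)) l].

Definition hip (f g : C -> C) : C :=
  let h t := boundary_value f t * conjc (boundary_value g t) in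
  let mu := @lebesgue_measure R in
  (real_complex _ (2 * pi)^-1) *
  Complex (\int[mu]_(t in `[0, 2 * pi]) complex.Re (h t))
          (\int[mu]_(t in `[0, 2 * pi]) complex.Im (h t)).

Definition hnorm (f : C -> C) : R := Num.sqrt (complex.Re (hip f f)).

(* The parameters a_1, ..., a_n are indexed from 0: TM a k is the function    *)
(* E_{a_1, ..., a_(k+1)} of the first k + 1 parameters.                       *)
Definition TM (n : nat) (a : 'I_n -> C) (k : 'I_n) (z : C) : C :=
  real_complex _ (Num.sqrt (1 - cmod (a k) ^+ 2)) / (1 - conjc (a k) * z) *
  \prod_(j < n | (j < k)%N) ((z - a j) / (1 - conjc (a j) * z)).

Definition blaschke_form (m : nat) (a c : 'I_m -> C) (z : C) : C :=
  \sum_(k < m) c k * TM a k z.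

Definition is_blaschke_form (m : nat) (f : C -> C) : Prop :=
  exists a c : 'I_m -> C, (forall k, unit_disc (a k)) /\
    (forall z, unit_disc z -> f z = blaschke_form a c z).

(* The last coefficient exists (so m >= 1) and is nonzero. *)
Definition nondegenerate_coefs (m : nat) (c : 'I_m -> C) : Prop :=
  exists k : 'I_m, k.+1 = m /\ c k <> 0.

Definition TM_coef (n : nat) (f : C -> C) (a : 'I_n -> C) (k : 'I_n) : C :=
  hip f (TM a k).

Definition TM_dist (n : nat) (f : C -> C) (a : 'I_n -> C) : R :=
  hnorm (fun z => f z - blaschke_form a (TM_coef f a) z).

End HardySpace.

(* Main.v *)
Require Import Defs.
From mathcomp Require Import all_boot all_order all_algebra.
From mathcomp Require Import complex ring lra.
From mathcomp Require Import all_classical all_reals all_analysis.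
From mathcomp Require Import measurable_realfun.

(** Write [c] for the Taylor coefficients of [f] and [b_a] for the Blaschke
factor [(z - a) / (1 - conj a z)].  One step of the Takenaka-Malmquist
expansion at [a] removes from [f] its component along the kernel [e_a] and
divides the rest, which vanishes at [a], by [b_a]; call the result [A_a f].
After the steps [a_1, ..., a_n],
[f = sum_k <f, E_k> E_k + b_{a_1} ... b_{a_n} A_{a_n} ... A_{a_1} f] and
[<f, E_k> = sqrt (1 - |a_k|^2) (A_{a_(k-1)} ... A_{a_1} f) (a_k)].
Blaschke products have modulus one on the circle, so the approximation error is
the norm of [A_{a_n} ... A_{a_1} f], and the problem is to minimise that norm.

On coefficients [A_a] is the map [reduce a] below.  It satisfies
[||A_a f||^2 = ||f||^2 - (1 - |a|^2) |f(a)|^2] ([reduce_nsq], a telescoping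
sum), hence is a contraction.  The formula for [A_a] extends to [|a| = 1],
where [A_a f = - conj a f], and for fixed [f] the vector [A_a f] depends
continuously on [a] in the CLOSED disc ([reduce_cont]: clear for polynomials,
which are dense, and contractions allow the passage to the limit).  So the error
attains its minimum over the closed polydisc ([min_exists]).  A parameter on the
unit circle does not change the norm.  If a minimiser had such a parameter, or
if its last coefficient vanished, the same error would be attained with fewer
than [n] points of the open disc; the remainder [h] is then not zero, as [f] is
not a Blaschke form of smaller order, and one more step at a point where
[h] does not vanish would be strictly better ([improve]).  This is [l2_best].

What remains is that the inner product, defined through non-tangential limits
and Lebesgue integrals, is the inner product of coefficient sequences
([hip_l2dot]).  The heart of this is the theorem of Fatou ([fatou_theorem]).
For a polynomial [g] the Poisson formula bounds [|g|] on a non-tangential region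
at [e^{it}] by the Hardy-Littlewood maximal function of its boundary values
([nontangential_maximal]).  Applied to the square of [g], the weak-type maximal
inequality then controls the non-tangential supremum of [|g|] by the norm of [g]
in [L^2] ([maximal_weak]).  For partial sums of [f] that converge fast, the
Borel-Cantelli lemma gives uniform convergence on almost every non-tangential
region.  The lemma of Fatou on integrals identifies the norm of the
limit ([bdry_exists]), and polarisation gives the inner product. *)

Set Implicit Arguments.
Unset Strict Implicit.
Unset Printing Implicit Defensive.
Import Order.TTheory GRing.Theory Num.Theory.
Import numFieldNormedType.Exports.
Local Open Scope classical_set_scope.
Local Open Scope ring_scope.
Local Open Scope complex_scope.

(** * Complex modulus, series and square-summable sequences *)

#[global] Arguments cmod : simpl never.

Section Modulus.
Context {R : realType}.
Local Notation C := R[i].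
Implicit Types (z w : C).

Lemma norm_cmod z : `|z| = (cmod z)%:C. Proof. by []. Qed.
Lemma cmod_ge0 z : 0 <= cmod z.
Proof. by rewrite -lecR -norm_cmod normr_ge0. Qed.
Lemma cmod0 : cmod (0 : C) = 0.
Proof. exact: ComplexField.Normc.normc0. Qed.
Lemma cmod1 : cmod (1 : C) = 1.
Proof. exact: ComplexField.Normc.normc1. Qed.
Lemma cmodM z w : cmod (z * w) = cmod z * cmod w.
Proof. exact: ComplexField.Normc.normcM. Qed.
Lemma cmodV z : cmod z^-1 = (cmod z)^-1.
Proof. exact: ComplexField.Normc.normcV. Qed.
Lemma cmodX z n : cmod (z ^+ n) = cmod z ^+ n.
Proof. by elim: n => [|n IH]; rewrite ?cmod1// !exprS cmodM IH. Qed.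
Lemma cmodN z : cmod (- z) = cmod z.
Proof. by apply: complexI; rewrite -!norm_cmod normrN. Qed.
Lemma cmodBC z w : cmod (z - w) = cmod (w - z).
Proof. by rewrite -cmodN opprB. Qed.
Lemma cmodD z w : cmod (z + w) <= cmod z + cmod w.
Proof. by rewrite -lecR rmorphD/= -!norm_cmod ler_normD. Qed.
Lemma cmodB z w : cmod z - cmod w <= cmod (z - w).
Proof. by rewrite lerBlDr (le_trans _ (cmodD _ _)) ?subrK. Qed.
Lemma cmod_eq0 z : (cmod z == 0) = (z == 0).
Proof. by rewrite -(inj_eq (@complexI R)) -norm_cmod normr_eq0. Qed.
Lemma cmod_real (x : R) : cmod x%:C = `|x|.
Proof. by rewrite /cmod /ComplexField.Normc.normc/= expr0n/= addr0 sqrtr_sqr. Qed.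
Lemma cmodJ z : cmod (conjc z) = cmod z.
Proof. by case: z => a b; rewrite /cmod/= sqrrN. Qed.
Lemma sqr_cmod z : cmod z ^+ 2 = complex.Re z ^+ 2 + complex.Im z ^+ 2.
Proof. by case: z => a b; rewrite /cmod/= sqr_sqrtr// addr_ge0// sqr_ge0. Qed.
Lemma mulcJ z : z * conjc z = (cmod z ^+ 2)%:C.
Proof.
rewrite sqr_cmod; case: z => a b; simpc; apply/eqP.
by rewrite eq_complex/=; apply/andP; split; apply/eqP; ring.
Qed.
Lemma ler_Re z : `|complex.Re z| <= cmod z.
Proof.
by rewrite -ler_sqr ?nnegrE ?cmod_ge0// real_normK ?num_real// sqr_cmod lerDl sqr_ge0.
Qed.
Lemma ler_Im z : `|complex.Im z| <= cmod z.
Proof.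
by rewrite -ler_sqr ?nnegrE ?cmod_ge0// real_normK ?num_real// sqr_cmod lerDr sqr_ge0.
Qed.
Lemma cmod_leD z : cmod z <= `|complex.Re z| + `|complex.Im z|.
Proof.
rewrite -ler_sqr ?nnegrE ?cmod_ge0 ?addr_ge0// sqr_cmod sqrrD !real_normK ?num_real//.
by rewrite addrAC lerDl mulrn_wge0// mulr_ge0.
Qed.

(** The weight [e] is free, so that this one inequality serves both for the
triangle inequality of the norm ([nrmD]) and for comparing integrals of
squares. *)
Lemma sqr_cmodD z w (e : R) : 0 < e ->
  cmod (z + w) ^+ 2 <= (1 + e) * cmod z ^+ 2 + (1 + e^-1) * cmod w ^+ 2.
Proof.
move=> e0; apply: (@le_trans _ _ ((cmod z + cmod w) ^+ 2)).
  by rewrite ler_sqr ?nnegrE ?addr_ge0 ?cmod_ge0// cmodD.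
move: (cmod z) (cmod w) => x y; rewrite -subr_ge0.
have -> : (1 + e) * x ^+ 2 + (1 + e^-1) * y ^+ 2 - (x + y) ^+ 2 = e^-1 * (e * x - y) ^+ 2.
  by field; rewrite gt_eqF.
by rewrite mulr_ge0 ?invr_ge0 ?sqr_ge0// ltW.
Qed.

Lemma cvgC T (F : set_system T) (FF : Filter F) (f : T -> C) (l : C) :
  (f @ F --> l) <-> ((fun x => cmod (f x - l)) @ F --> (0 : R)).
Proof.
split=> [/cvgrPdist_lt H|/cvgrPdist_lt H]; apply/cvgrPdist_lt => e e0.
  have e0' : 0 < e%:C by rewrite ltcR.
  near=> x; have : `|l - f x| < e%:C by near: x; exact: H.
  by move=> h; rewrite sub0r normrN ger0_norm ?cmod_ge0// -ltcR -norm_cmod distrC.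
case: e e0 => e b; rewrite ltcE/= => /andP[/eqP -> e0].
near=> x; have : `|0 - cmod (f x - l)| < e by near: x; exact: H.
rewrite sub0r normrN ger0_norm ?cmod_ge0// -ltcR cmodBC.
by [].
Unshelve. all: by end_near. Qed.

Lemma cvgC_split T (F : set_system T) (FF : Filter F) (f : T -> C) (l : C) :
  (f @ F --> l) <-> ((fun x => complex.Re (f x)) @ F --> complex.Re l) /\
     ((fun x => complex.Im (f x)) @ F --> complex.Im l).
Proof.
split=> [/cvgC /cvgrPdist_lt H|[/cvgrPdist_lt H1 /cvgrPdist_lt H2]].
  split; apply/cvgrPdist_lt => e e0; near=> x;
    (have : `|0 - cmod (f x - l)| < e by near: x; exact: H);
    rewrite sub0r normrN ger0_norm ?cmod_ge0//; apply: le_lt_trans;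
    rewrite -raddfB/= cmodBC; [exact: ler_Re|exact: ler_Im].
apply/cvgC/cvgrPdist_lt => e e0; near=> x.
rewrite sub0r normrN ger0_norm ?cmod_ge0// (le_lt_trans (cmod_leD _))//.
rewrite !raddfB/= [e]splitr ltrD// distrC; near: x; [apply: H1|apply: H2];
  by rewrite divr_gt0.
Unshelve. all: by end_near. Qed.

Lemma cvgC_unique T (F : set_system T) (FF : ProperFilter F) (f : T -> C) (l l' : C) :
  f @ F --> l -> f @ F --> l' -> l = l'.
Proof. by move=> h h'; apply: (cvg_unique _ h h'); exact: norm_hausdorff. Qed.

End Modulus.

Section Series.
Context {R : realType}.
Local Notation C := R[i].
Implicit Types (u v c d : nat -> C) (a z : C).

Definition summ u := cvgn (series (fun k => cmod (u k))).

(** The sum of a complex series, as a total function: the convergence theory of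
real series applies to its two components. *)
Definition csum u : C :=
  Complex (limn (series (fun k => complex.Re (u k))))
          (limn (series (fun k => complex.Im (u k)))).

Lemma Re_series u n : complex.Re (series u n) = series (fun k => complex.Re (u k)) n.
Proof. by rewrite /series/= raddf_sum. Qed.
Lemma Im_series u n : complex.Im (series u n) = series (fun k => complex.Im (u k)) n.
Proof. by rewrite /series/= raddf_sum. Qed.

Lemma csum_cvg u : summ u -> series u @ \oo --> csum u.
Proof.
move=> su; apply/cvgC_split; split.
  under eq_cvg do rewrite Re_series.
  apply: (@normed_cvg R); apply: series_le_cvg su => n.
  - exact: normr_ge0.
  - exact: cmod_ge0.
  - exact: ler_Re.
under eq_cvg do rewrite Im_series.
apply: (@normed_cvg R); apply: series_le_cvg su => n.
- exact: normr_ge0.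
- exact: cmod_ge0.
- exact: ler_Im.
Qed.

Lemma csum_unique u l : series u @ \oo --> l -> csum u = l.
Proof.
move=> /cvgC_split[]; under eq_cvg do rewrite Re_series.
under [X in _ -> X -> _]eq_cvg do rewrite Im_series.
case: l => x y /= h1 h2; rewrite /csum; congr Complex; apply: cvg_lim => //.
Qed.

Lemma summ_geo c z (B : R) : (forall k, cmod (c k) <= B) -> cmod z < 1 ->
  summ (fun k => c k * z ^+ k).
Proof.
move=> cB z1; apply: (@series_le_cvg _ _ (fun k => B * cmod z ^+ k)).
- by move=> n; exact: cmod_ge0.
- by move=> n; rewrite mulr_ge0 ?exprn_ge0 ?cmod_ge0// (le_trans _ (cB n))// cmod_ge0.
- by move=> n; rewrite cmodM cmodX ler_wpM2r// exprn_ge0// cmod_ge0.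
- by apply: is_cvg_geometric_series; rewrite ger0_norm// cmod_ge0.
Qed.

Definition l2 c := cvgn (series (fun k => cmod (c k) ^+ 2)).
Definition nsq c : R := limn (series (fun k => cmod (c k) ^+ 2)).

Lemma series_nsq_nd c : nondecreasing_seq (series (fun k => cmod (c k) ^+ 2)).
Proof. by apply: nondecreasing_series => n *; exact: sqr_ge0. Qed.

Lemma nsq_ub c n : l2 c -> series (fun k => cmod (c k) ^+ 2) n <= nsq c.
Proof. by move=> lc; apply: nondecreasing_cvgn_le => //; exact: series_nsq_nd. Qed.

Lemma l2_bound c B : (forall n, series (fun k => cmod (c k) ^+ 2) n <= B) -> l2 c.
Proof.
move=> H; apply: nondecreasing_is_cvgn; first exact: series_nsq_nd.
by exists B => _ [n _ <-]; exact: H.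
Qed.

Lemma nsq_le c B : (forall n, series (fun k => cmod (c k) ^+ 2) n <= B) -> nsq c <= B.
Proof.
by move=> H; apply: limr_le; [exact: l2_bound H|exact: nearW].
Qed.

Lemma nsq_ge0 c : 0 <= nsq c.
Proof.
rewrite /nsq; have [/nsq_ub H|h] := pselect (l2 c).
  by apply: le_trans (H 0%N); rewrite /series/= big_geq.
by rewrite (dvgP h).
Qed.

Lemma l2_term c k : l2 c -> cmod (c k) ^+ 2 <= nsq c.
Proof.
move=> /nsq_ub - /(_ k.+1); apply: le_trans.
by rewrite /series/= big_nat_recr//= lerDr sumr_ge0// => i _; exact: sqr_ge0.
Qed.

Lemma l2_bounded c : l2 c -> forall k, cmod (c k) <= Num.sqrt (nsq c).
Proof.
move=> lc k; rewrite -ler_sqr ?nnegrE ?cmod_ge0 ?sqrtr_ge0// sqr_sqrtr ?nsq_ge0//.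
exact: l2_term.
Qed.

Lemma l2_cvg0 c : l2 c -> (fun k => cmod (c k) ^+ 2) @ \oo --> (0 : R).
Proof. exact: cvg_series_cvg_0. Qed.

Lemma nsqP c : l2 c -> series (fun k => cmod (c k) ^+ 2) @ \oo --> nsq c.
Proof. by []. Qed.

End Series.

#[global] Arguments csum : simpl never.
#[global] Arguments nsq : simpl never.

Section L2.
Context {R : realType}.
Local Notation C := R[i].
Implicit Types (u v c d : nat -> C) (a z : C).

Lemma nsqD_le c d (e : R) : 0 < e -> l2 c -> l2 d ->
  nsq (fun k => c k + d k) <= (1 + e) * nsq c + (1 + e^-1) * nsq d
  /\ l2 (fun k => c k + d k).
Proof.
move=> e0 lc ld; set B := (X in _ <= X).
suff H n : series (fun k => cmod (c k + d k) ^+ 2) n <= B.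
  by split; [exact: nsq_le H|exact: l2_bound H].
apply: (@le_trans _ _ ((1 + e) * series (fun k => cmod (c k) ^+ 2) n +
     (1 + e^-1) * series (fun k => cmod (d k) ^+ 2) n)).
  rewrite /series/= !mulr_sumr -big_split/= ler_sum// => i _.
  exact: sqr_cmodD.
by rewrite lerD// ler_wpM2l ?nsq_ub ?addr_ge0 ?invr_ge0// ltW.
Qed.

Lemma l2D c d : l2 c -> l2 d -> l2 (fun k => c k + d k).
Proof. by move=> lc ld; exact: (nsqD_le ltr01 lc ld).2. Qed.

Lemma nsqZ_series (u : C) c n : series (fun k => cmod (u * c k) ^+ 2) n =
  cmod u ^+ 2 * series (fun k => cmod (c k) ^+ 2) n.
Proof.
by rewrite /series/= mulr_sumr; apply: eq_bigr => i _; rewrite cmodM exprMn.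
Qed.

Lemma l2Z (u : C) c : l2 c -> l2 (fun k => u * c k).
Proof.
move=> lc; apply: (@l2_bound _ _ (cmod u ^+ 2 * nsq c)) => n.
by rewrite nsqZ_series ler_wpM2l ?sqr_ge0// nsq_ub.
Qed.

Lemma nsqZ (u : C) c : l2 c -> nsq (fun k => u * c k) = cmod u ^+ 2 * nsq c.
Proof.
move=> lc; apply: cvg_lim => //.
under eq_cvg do rewrite nsqZ_series.
by apply: cvgMr; exact: nsqP.
Qed.

Lemma l2N c : l2 c -> l2 (fun k => - c k).
Proof.
by move=> /(@l2Z (-1) _) h; have -> : (fun k => - c k) = (fun k => -1 * c k)
  by apply/funext => k; rewrite mulN1r.
Qed.
Lemma l2B c d : l2 c -> l2 d -> l2 (fun k => c k - d k).
Proof. by move=> lc /l2N ld; exact: l2D. Qed.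

Definition nrm c : R := Num.sqrt (nsq c).

Lemma nrm_ge0 c : 0 <= nrm c. Proof. exact: sqrtr_ge0. Qed.
Lemma sqr_nrm c : nrm c ^+ 2 = nsq c. Proof. by rewrite sqr_sqrtr// nsq_ge0. Qed.

Lemma nrmN c : nrm (fun k => - c k) = nrm c.
Proof.
rewrite /nrm; congr Num.sqrt; rewrite /nsq.
by under eq_fun do rewrite cmodN.
Qed.

Lemma nrmBC c d : nrm (fun k => c k - d k) = nrm (fun k => d k - c k).
Proof. by rewrite -nrmN; under eq_fun do rewrite opprB. Qed.

(** Optimise the weight in [nsqD_le]: [(||d|| + e/2) / (||c|| + e/2)], where the
shift by [e/2] avoids dividing by zero. *)
Lemma nrmD c d : l2 c -> l2 d -> nrm (fun k => c k + d k) <= nrm c + nrm d.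
Proof.
move=> lc ld; apply/ler_addgt0Pr => e e0.
have X0 : 0 < nrm c + e / 2 by rewrite ltr_wpDl ?nrm_ge0// divr_gt0.
have Y0 : 0 < nrm d + e / 2 by rewrite ltr_wpDl ?nrm_ge0// divr_gt0.
rewrite -ler_sqr ?nnegrE ?addr_ge0 ?nrm_ge0 ?(ltW e0)//.
set X := nrm c + e / 2; set Y := nrm d + e / 2.
rewrite sqr_nrm (le_trans (nsqD_le (divr_gt0 Y0 X0) lc ld).1)//.
have -> : nrm c + nrm d + e = X + Y by rewrite /X /Y; lra.
have -> : (X + Y) ^+ 2 = (1 + Y / X) * X ^+ 2 + (1 + (Y / X)^-1) * Y ^+ 2.
  by field; rewrite /X /Y; apply/andP; split; rewrite gt_eqF.
have hle (w x : R) : 0 <= w -> w <= x -> w ^+ 2 <= x ^+ 2.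
  by move=> w0 wx; rewrite ler_sqr// nnegrE// (le_trans w0).
have e2 : 0 <= e / 2 by rewrite ltW// divr_gt0.
apply: lerD; apply: ler_wpM2l;
  rewrite ?addr_ge0 ?invr_ge0 ?divr_ge0 ?(ltW X0) ?(ltW Y0)// -sqr_nrm hle ?nrm_ge0//.
- by rewrite /X lerDl.
- by rewrite /Y lerDl.
Qed.

Lemma nrm_subC c d e : l2 c -> l2 d -> l2 e ->
  nrm (fun k => c k - e k) <= nrm (fun k => c k - d k) + nrm (fun k => d k - e k).
Proof.
move=> lc ld le; apply: le_trans (nrmD (l2B lc ld) (l2B ld le)).
by under [X in _ <= nrm X]eq_fun do rewrite addrA subrK.
Qed.

Lemma nrm_dist c d : l2 c -> l2 d -> nrm c - nrm d <= nrm (fun k => c k - d k).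
Proof.
move=> lc ld; rewrite lerBlDr; apply: le_trans (nrmD (l2B lc ld) ld).
by under [X in _ <= nrm X]eq_fun do rewrite subrK.
Qed.

Lemma summZ a u : summ u -> summ (fun k => a * u k).
Proof.
rewrite /summ => su.
have -> : series (fun k => cmod (a * u k)) = (fun n => cmod a * series (fun k => cmod (u k)) n).
  by apply/funext => n; rewrite /series/= mulr_sumr; apply: eq_bigr => i _; rewrite cmodM.
by apply: is_cvgMr.
Qed.
Lemma csumZ a u : summ u -> csum (fun k => a * u k) = a * csum u.
Proof.
move=> su; apply: csum_unique.
have -> : series (fun k => a * u k) = (fun n => a * series u n).
  by apply/funext => n; rewrite /series/= mulr_sumr.
by apply: cvgMr; exact: csum_cvg.
Qed.
Lemma csumD u v : summ u -> summ v -> csum (fun k => u k + v k) = csum u + csum v.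
Proof.
move=> su sv; apply: csum_unique.
have -> : series (fun k => u k + v k) = (fun n => series u n + series v n).
  by apply/funext => n; rewrite /series/= big_split.
by apply: cvgD; exact: csum_cvg.
Qed.
Lemma csum_recl u : summ (fun k => u k.+1) -> csum u = u 0%N + csum (fun k => u k.+1).
Proof.
move=> su; apply: csum_unique; rewrite -cvg_shiftS/=.
have -> : (fun n => series u n.+1) = (fun n => u 0%N + series (fun k => u k.+1) n).
  by apply/funext => n; rewrite /series/= big_nat_recl.
by apply: cvgD; [exact: cvg_cst|exact: csum_cvg].
Qed.

Lemma csum_le u (B : R) : (forall n, series (fun k => cmod (u k)) n <= B) ->
  cmod (csum u) <= B.
Proof.
move=> H.
have su : summ u.
  apply: nondecreasing_is_cvgn; last by exists B => _ [n _ <-]; exact: H.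
  by apply: nondecreasing_series => n *; exact: cmod_ge0.
have /cvgC cu := csum_cvg su.
apply/ler_addgt0Pr => e e0; move/cvgrPdist_lt : cu => /(_ _ e0)[N _ /(_ N (leqnn N))].
rewrite sub0r normrN ger0_norm ?cmod_ge0// => h.
rewrite -[csum u](subKr (series u N)).
rewrite (le_trans (cmodD _ _))// lerD//; last by rewrite cmodN ltW.
rewrite (le_trans _ (H N))// /series/=.
elim/big_ind2 : _ => //; first by rewrite cmod0.
by move=> x1 x2 y1 y2 h1 h2; rewrite (le_trans (cmodD _ _))// lerD.
Qed.

Lemma geo_le (x : R) n : 0 <= x -> x < 1 -> \sum_(0 <= k < n) x ^+ k <= (1 - x)^-1.
Proof.
move=> x0 x1; rewrite -[leRHS]mul1r ler_pdivlMr ?subr_gt0//.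
elim: n => [|n IH]; first by rewrite big_geq// mul0r.
rewrite big_nat_recl//= expr0.
under eq_bigr do rewrite exprS.
rewrite -mulr_sumr mulrDl mul1r -mulrA.
by have := ler_wpM2l x0 IH; rewrite mulr1; lra.
Qed.

Lemma geo_half_le n : \sum_(0 <= k < n) 2^-1 ^+ k <= 2 :> R.
Proof.
have h2 : 1 - 2^-1 = 2^-1 :> R by lra.
by rewrite -[leRHS]invrK -[X in _ <= X^-1]h2; apply: geo_le; lra.
Qed.

Lemma csum_geo_le c z (B : R) : (forall k, cmod (c k) <= B) -> cmod z < 1 ->
  cmod (csum (fun k => c k * z ^+ k)) <= B / (1 - cmod z).
Proof.
move=> cB z1; apply: csum_le => n.
apply: (@le_trans _ _ (\sum_(0 <= k < n) B * cmod z ^+ k)).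
  rewrite /series/= ler_sum// => i _.
  by rewrite cmodM cmodX ler_wpM2r// exprn_ge0// cmod_ge0.
rewrite -mulr_sumr ler_wpM2l ?geo_le ?cmod_ge0//.
exact: le_trans (cmod_ge0 _) (cB 0%N).
Qed.

Definition psum c z : C := csum (fun k => c k * z ^+ k).
(** [tail c a k] is the value at [a] of the power series [c] shifted [k] times.
These are the coefficients of [(z f(z) - a f(a)) / (z - a)]. *)
Definition tail c a k : C := psum (fun j => c (k + j)%N) a.

Lemma psum0 z : psum (fun=> 0) z = 0.
Proof.
apply: csum_unique; rewrite [X in X @ _](_ : _ = fun=> 0); first exact: cvg_cst.
by apply/funext => n; rewrite /series/= big1// => i _; rewrite mul0r.
Qed.

Lemma tail0 c a : tail c a 0 = psum c a. Proof. by []. Qed.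

Lemma summ_l2 c z : l2 c -> cmod z < 1 -> summ (fun k => c k * z ^+ k).
Proof. by move=> /l2_bounded; exact: summ_geo. Qed.

Lemma l2_shift c m : l2 c -> l2 (fun j => c (m + j)%N).
Proof.
move=> lc; apply: (@l2_bound _ _ (nsq c)) => n.
apply: le_trans (nsq_ub (m + n) lc).
rewrite /series/= (big_cat_nat (leq0n m) (leq_addr n m))/=.
rewrite -[in X in _ <= _ + X](add0n m) big_addn addnC addnK; under [X in _ <= _ + X]eq_bigr do rewrite addnC.
by rewrite lerDr sumr_ge0// => i _; exact: sqr_ge0.
Qed.

Lemma psum_recl c z : l2 c -> cmod z < 1 ->
  psum c z = c 0%N + z * psum (fun k => c k.+1) z.
Proof.
move=> lc z1; have ls := @l2_shift c 1 lc.
rewrite /psum -csumZ; last exact: summ_l2.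
have E : (fun k => z * (c k.+1 * z ^+ k)) = (fun k => c k.+1 * z ^+ k.+1).
  by apply/funext => k; rewrite exprS mulrCA.
rewrite E csum_recl ?expr0 ?mulr1// -E; apply: summZ.
exact: (@summ_l2 (fun k => c k.+1)).
Qed.
End L2.

(** * One step of the Takenaka-Malmquist expansion *)

Section reduce.
Context {R : realType}.
Local Notation C := R[i].
Implicit Types (u v c d : nat -> C) (a z : C).

(** In terms of functions this is
[((1 - conj a z) f(z) - (1 - |a|^2) f(a)) / (z - a)], that is, [f] minus its
component along the kernel at [a], divided by the Blaschke factor; see
[psum_reduce].  The factor [1 - |a|^2] is kept outside [tail], so that the
formula is meaningful for [|a| = 1], where the series [tail] need not
converge. *)
Definition reduce a c k : C :=
  (1 - cmod a ^+ 2)%:C * tail c a k.+1 - conjc a * c k.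

Lemma tail_rec c a k : l2 c -> cmod a < 1 -> tail c a k = c k + a * tail c a k.+1.
Proof.
move=> lc a1; rewrite /tail psum_recl//; last exact: l2_shift.
by rewrite addn0; under [in LHS]eq_fun do rewrite addnS -addSn.
Qed.

Lemma reduceE c a k : l2 c -> cmod a < 1 ->
  reduce a c k = tail c a k.+1 - conjc a * tail c a k.
Proof.
move=> lc a1; rewrite /reduce [tail c a k]tail_rec//.
by rewrite rmorphB/= -mulcJ rmorph1; ring.
Qed.

Lemma tail_bound c a : l2 c -> cmod a < 1 -> forall k,
  cmod (tail c a k) <= Num.sqrt (nsq c) / (1 - cmod a).
Proof.
move=> lc a1 k; apply: csum_geo_le => // j; exact: l2_bounded.
Qed.

Lemma tail_cvg0 c a : l2 c -> cmod a < 1 ->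
  (fun k => cmod (tail c a k) ^+ 2) @ \oo --> (0 : R).
Proof.
move=> lc a1; have [a1' l0] : 0 < 1 - cmod a /\ (fun k => cmod (c k) ^+ 2) @ \oo --> (0:R).
  by rewrite subr_gt0; split=> //; exact: l2_cvg0.
apply/cvgrPdist_le => e e0.
have d0 : 0 < e * (1 - cmod a) ^+ 2 by rewrite mulr_gt0// exprn_gt0.
move/cvgrPdist_le : l0 => /(_ _ d0)[N _ HN]; exists N => // k /= Nk.
rewrite sub0r normrN ger0_norm ?sqr_ge0//.
have {}HN j : cmod (c (k + j)%N) <= Num.sqrt e * (1 - cmod a).
  have := HN (k + j)%N (leq_trans Nk (leq_addr _ _)).
  rewrite sub0r normrN ger0_norm ?sqr_ge0// => h.
  by rewrite -ler_sqr ?nnegrE ?cmod_ge0 ?mulr_ge0 ?sqrtr_ge0 ?(ltW a1')// exprMn sqr_sqrtr// ltW.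
have := csum_geo_le HN a1; rewrite mulfK ?gt_eqF// => h.
rewrite -[leRHS]sqr_sqrtr ?(ltW e0)// ler_sqr ?nnegrE ?cmod_ge0 ?sqrtr_ge0//.
Qed.

(** With [p = tail c a k] and [q = tail c a k.+1] one has [c k = p - a q] and
[reduce a c k = q - conj a p]: the cross terms of the two squared moduli agree,
and the difference telescopes in [k]. *)
Lemma reduce_telescope (a p q : C) :
  cmod (q - conjc a * p) ^+ 2 =
  cmod (p - a * q) ^+ 2 - (1 - cmod a ^+ 2) * (cmod p ^+ 2 - cmod q ^+ 2).
Proof.
by rewrite !sqr_cmod; case: a p q => [a1 a2] [p1 p2] [q1 q2]; simpc => /=; ring.
Qed.

Lemma reduce_series c a n : l2 c -> cmod a < 1 ->
  series (fun k => cmod (reduce a c k) ^+ 2) n =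
  series (fun k => cmod (c k) ^+ 2) n
   - (1 - cmod a ^+ 2) * (cmod (psum c a) ^+ 2 - cmod (tail c a n) ^+ 2).
Proof.
move=> lc a1; rewrite -tail0; elim: n => [|n IH].
  by rewrite /series/= !big_geq// subrr mulr0 subrr.
rewrite /series/= !big_nat_recr//=; move: IH; rewrite /series/= => ->.
rewrite reduceE// reduce_telescope.
have -> : tail c a n - a * tail c a n.+1 = c n by rewrite [tail c a n]tail_rec// addrK.
by ring.
Qed.

Lemma reduce_unimod c a k : cmod a = 1 -> reduce a c k = - conjc a * c k.
Proof. by move=> a1; rewrite /reduce a1 expr1n subrr mul0r sub0r mulNr. Qed.

(** The telescoping sum leaves the first term, [tail c a 0 = f(a)], and a last term
that tends to zero. *)
Lemma reduce_nsq c a : l2 c -> cmod a <= 1 -> l2 (reduce a c) /\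
  nsq (reduce a c) = nsq c - (1 - cmod a ^+ 2) * cmod (psum c a) ^+ 2.
Proof.
move=> lc; rewrite le_eqVlt => /predU1P[a1|a1].
  have -> : reduce a c = (fun k => - conjc a * c k).
    by apply/funext => k; rewrite reduce_unimod.
  by rewrite nsqZ// cmodN cmodJ a1 expr1n subrr mul0r subr0 mul1r; split=> //; exact: l2Z.
have H : series (fun k => cmod (reduce a c k) ^+ 2) @ \oo -->
    nsq c - (1 - cmod a ^+ 2) * cmod (psum c a) ^+ 2.
  under eq_cvg do rewrite reduce_series//.
  apply: cvgB; first exact: nsqP.
  apply: cvgMr; rewrite -[X in _ --> X]subr0; apply: cvgB; first exact: cvg_cst.
  exact: tail_cvg0.
by split; [apply: cvgP H|exact: cvg_lim H].
Qed.

Lemma psum_lin c d (s : C) z : l2 c -> l2 d -> cmod z < 1 ->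
  psum (fun k => c k + s * d k) z = psum c z + s * psum d z.
Proof.
move=> lc ld z1; rewrite /psum -csumZ; last exact: summ_l2.
rewrite -csumD; [|exact: summ_l2|by apply: summZ; exact: summ_l2].
by under eq_fun do rewrite mulrDl -mulrA.
Qed.

Lemma reduce_lin c d (s : C) a : l2 c -> l2 d -> cmod a <= 1 ->
  reduce a (fun k => c k + s * d k) = (fun k => reduce a c k + s * reduce a d k).
Proof.
move=> lc ld; rewrite le_eqVlt => /predU1P[a1|a1]; apply/funext => k.
  by rewrite !reduce_unimod//; ring.
rewrite /reduce /tail psum_lin//; [by ring|exact: l2_shift|exact: l2_shift].
Qed.

Lemma reduce_sub c d a : l2 c -> l2 d -> cmod a <= 1 ->
  reduce a (fun k => c k - d k) = (fun k => reduce a c k - reduce a d k).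
Proof.
move=> lc ld a1.
have -> : (fun k => c k - d k) = (fun k => c k + (-1) * d k).
  by apply/funext => k; rewrite mulN1r.
by rewrite reduce_lin//; apply/funext => k; rewrite mulN1r.
Qed.

Lemma l20 : l2 (fun=> 0 : C).
Proof.
apply: (@l2_bound _ _ 0) => n; rewrite /series/= big1// => i _.
by rewrite cmod0 expr0n.
Qed.

Lemma reduce_scal c (s : C) a : l2 c -> cmod a <= 1 ->
  reduce a (fun k => s * c k) = (fun k => s * reduce a c k).
Proof.
move=> lc a1; have := @reduce_lin (fun=> 0) c s a l20 lc a1.
have -> : (fun k => 0 + s * c k) = (fun k => s * c k) by apply/funext => k; rewrite add0r.
move=> ->; apply/funext => k; rewrite /reduce mulr0 subr0.
have -> : tail (fun=> 0) a k.+1 = 0.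
  exact: psum0.
by rewrite mulr0 add0r.
Qed.

Lemma psum_reduce c a z : l2 c -> cmod a < 1 -> cmod z < 1 ->
  (1 - conjc a * z) * psum c z =
  (z - a) * psum (reduce a c) z + (1 - cmod a ^+ 2)%:C * psum c a.
Proof.
move=> lc a1 z1.
pose q := fun k => tail c a k.+1.
have sq : summ (fun k => q k * z ^+ k).
  by apply: summ_geo z1 => k; exact: tail_bound.
have st : summ (fun k => tail c a k * z ^+ k).
  by apply: summ_geo z1 => k; exact: tail_bound.
have sc := summ_l2 lc z1.
have E1 : psum c z = psum (tail c a) z - a * psum q z.
  rewrite /psum -mulNr -csumZ// -csumD//; last exact: summZ.
  congr csum; apply/funext => k.
  by rewrite mulrA -mulrDl mulNr [tail c a k]tail_rec// addrK.
have E2 : psum (tail c a) z = psum c a + z * psum q z.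
  have Eq : (fun k => z * (q k * z ^+ k)) = (fun k => tail c a k.+1 * z ^+ k.+1).
    by apply/funext => k; rewrite exprS mulrCA.
  rewrite -(tail0 c a) /psum -csumZ// Eq.
  by rewrite -[in RHS](mulr1 (tail c a 0)) -(expr0 z) csum_recl// -Eq; exact: summZ.
have E3 : psum (reduce a c) z = (1 - cmod a ^+ 2)%:C * psum q z - conjc a * psum c z.
  rewrite /psum -(mulNr (conjc a)) -!csumZ// -csumD//; [|exact: summZ|exact: summZ].
  by congr csum; apply/funext => k; rewrite /reduce /q; ring.
rewrite E3 rmorphB/= -mulcJ rmorph1 E1 E2.
by ring.
Qed.

(** If [c m] is the first nonzero coefficient, the series is
[a^m (c m + O(a))], which does not vanish for small [a] different from zero. *)
Lemma psum_neq0 c : l2 c -> (exists k, c k != 0) ->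
  exists a, cmod a < 1 /\ psum c a != 0.
Proof.
move=> lc /ex_minnP[m cm mmin].
pose B := Num.sqrt (nsq c); have B0 : 0 <= B by exact: sqrtr_ge0.
pose e := cmod (c m); have e0 : 0 < e by rewrite lt_def cmod_ge0 cmod_eq0 cm.
pose x := e / (2 * e + 2 * B + 1)  : R.
have D0 : 0 < 2 * e + 2 * B + 1 by lra.
have x0 : 0 < x by rewrite divr_gt0.
have x2 : x < 2^-1 by rewrite ltr_pdivrMr//; lra.
have ax : cmod x%:C = x by rewrite cmod_real ger0_norm// ltW.
exists x%:C; rewrite ax; split; first by lra.
have x1 : cmod x%:C < 1 by rewrite ax; lra.
have H k : (k <= m)%N -> psum c x%:C = x%:C ^+ k * tail c x%:C k.
  elim: k => [|k IH] km; first by rewrite mul1r.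
  rewrite IH ?(ltnW km)// [tail c _ k]tail_rec//.
  have -> : c k = 0.
    by apply/eqP; apply/negPn/negP => /mmin; rewrite leqNgt km.
  by rewrite add0r exprSr mulrA.
rewrite (H m)// mulf_neq0// ?expf_neq0//.
  by rewrite -cmod_eq0 ax gt_eqF.
rewrite tail_rec// -cmod_eq0 gt_eqF//.
rewrite -[X in _ + X]opprK (lt_le_trans _ (cmodB _ _))// subr_gt0 cmodN cmodM ax.
have := tail_bound lc x1 m.+1; rewrite ax -/B -/e => h.
apply: (@le_lt_trans _ _ (x * (2 * B))).
  rewrite ler_wpM2l ?(ltW x0)// (le_trans h)// mulrC ler_wpM2r//.
  by rewrite -[leRHS]invrK lef_pV2 ?posrE; lra.
rewrite /x mulrAC ltr_pdivrMr// ltr_pM2l//; lra.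
Qed.

End reduce.

(** * Continuity up to the unit circle and existence of a minimiser *)

Lemma sum_ge_eq0 (V : nmodType) (f : nat -> V) m n :
  (forall i, (m <= i)%N -> f i = 0) -> \sum_(m <= i < n) f i = 0.
Proof. by move=> f0; rewrite big_nat_cond big1// => i /andP[/andP[/f0]]. Qed.

Lemma sum_lt_eq0 (V : nmodType) (f : nat -> V) m n :
  (forall i, (i < n)%N -> f i = 0) -> \sum_(m <= i < n) f i = 0.
Proof. by move=> f0; rewrite big_nat_cond big1// => i /andP[/andP[_ /f0]]. Qed.

Section Cont.
Context {R : realType}.
Local Notation C := R[i].
Implicit Types (u v c d : nat -> C) (a z : C).

Section filt.
Context {T : Type} {F : set_system T} {FF : Filter F}.

Lemma cvgC_sum (I : Type) (r : seq I) (f : I -> T -> C) (l : I -> C) :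
  (forall i, f i @ F --> l i) ->
  (fun x => \sum_(i <- r) f i x) @ F --> \sum_(i <- r) l i.
Proof.
move=> H; elim: r => [|i r IH].
  by rewrite big_nil; under eq_cvg do rewrite big_nil; exact: cvg_cst.
by rewrite big_cons; under eq_cvg do rewrite big_cons; apply: cvgD; [exact: H|exact: IH].
Qed.

Lemma cvgC_X (f : T -> C) (l : C) n : f @ F --> l -> (fun x => f x ^+ n) @ F --> l ^+ n.
Proof.
move=> H; elim: n => [|n IH].
  by rewrite expr0; under eq_cvg do rewrite expr0; exact: cvg_cst.
by rewrite exprS; under eq_cvg do rewrite exprS; apply: cvgM; [exact: H|exact: IH].
Qed.

Lemma cvgC_conj (f : T -> C) (l : C) : f @ F --> l -> (fun x => conjc (f x)) @ F --> conjc l.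
Proof.
move=> /cvgC H; apply/cvgC.
by under eq_cvg do rewrite -rmorphB/= cmodJ.
Qed.

Lemma cvgR_X (f : T -> R) (l : R) n : f @ F --> l -> (fun x => f x ^+ n) @ F --> l ^+ n.
Proof.
move=> H; elim: n => [|n IH].
  by rewrite expr0; under eq_cvg do rewrite expr0; exact: cvg_cst.
by rewrite exprS; under eq_cvg do rewrite exprS; apply: cvgM; [exact: H|exact: IH].
Qed.

Lemma cvgR_sum (I : Type) (r : seq I) (f : I -> T -> R) (l : I -> R) :
  (forall i, f i @ F --> l i) ->
  (fun x => \sum_(i <- r) f i x) @ F --> \sum_(i <- r) l i.
Proof.
move=> H; elim: r => [|i r IH].
  by rewrite big_nil; under eq_cvg do rewrite big_nil; exact: cvg_cst.
by rewrite big_cons; under eq_cvg do rewrite big_cons; apply: cvgD; [exact: H|exact: IH].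
Qed.

Lemma tail_fin d a k N : (forall j, (N <= j)%N -> d j = 0) ->
  tail d a k = \sum_(0 <= j < N) d (k + j)%N * a ^+ j.
Proof.
move=> dN; apply: csum_unique; apply/cvgC/cvgrPdist_lt => e e0.
exists N => // n /= Nn; rewrite /series/= (big_cat_nat (leq0n N) Nn)/=.
rewrite [X in 0 - cmod X]addrAC subrr !add0r sum_ge_eq0 ?cmod0 ?oppr0 ?normr0 // => i Ni.
by rewrite dN ?mul0r// (leq_trans Ni)// leq_addl.
Qed.

Lemma reduce_fin_cvg (g : T -> C) a d N k : (forall j, (N <= j)%N -> d j = 0) ->
  g @ F --> a -> (fun x => reduce (g x) d k) @ F --> reduce a d k.
Proof.
move=> dN ga; rewrite /reduce; apply: cvgB; last by apply: cvgMl; exact: cvgC_conj.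
rewrite (tail_fin _ _ dN); under eq_cvg do rewrite (tail_fin _ _ dN).
apply: cvgM; last by apply: cvgC_sum => i; apply: cvgMr; exact: cvgC_X.
rewrite rmorphB/= -mulcJ rmorph1; under eq_cvg do rewrite rmorphB/= -mulcJ rmorph1.
by apply: cvgB; [exact: cvg_cst|apply: cvgM; [exact: ga|exact: cvgC_conj ga]].
Qed.

Lemma reduce_finz a d N : (forall j, (N <= j)%N -> d j = 0) ->
  forall j, (N <= j)%N -> reduce a d j = 0.
Proof.
move=> dN j Nj; rewrite /reduce (tail_fin _ _ dN) dN// mulr0 subr0 big1 ?mulr0// => i _.
by rewrite dN ?mul0r// (leq_trans Nj)// addSn leqW// leq_addr.
Qed.

Lemma nsq_fin d N : (forall j, (N <= j)%N -> d j = 0) ->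
  l2 d /\ nsq d = \sum_(0 <= j < N) cmod (d j) ^+ 2.
Proof.
move=> dN.
have H : series (fun k => cmod (d k) ^+ 2) @ \oo --> \sum_(0 <= j < N) cmod (d j) ^+ 2.
  apply/cvgrPdist_lt => e e0.
  exists N => // n /= Nn; rewrite /series/= (big_cat_nat (leq0n N) Nn)/=.
  rewrite opprD addrA subrr sub0r sum_ge_eq0 ?oppr0 ?normr0// => i Ni.
  by rewrite dN ?cmod0 ?expr0n.
by split; [apply: cvgP H|exact: cvg_lim H].
Qed.

Lemma reduce_fin_nrm (g : T -> C) a d N : (forall j, (N <= j)%N -> d j = 0) ->
  g @ F --> a -> (fun x => nrm (fun k => reduce (g x) d k - reduce a d k)) @ F --> (0 : R).
Proof.
move=> dN ga.
have HN x j : (N <= j)%N -> reduce (g x) d j - reduce a d j = 0.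
  by move=> Nj; rewrite !(reduce_finz _ dN Nj) subrr.
have E x : nrm (fun k => reduce (g x) d k - reduce a d k) =
  Num.sqrt (\sum_(0 <= k < N) cmod (reduce (g x) d k - reduce a d k) ^+ 2).
  by rewrite /nrm (nsq_fin (HN x)).2.
pose S x := \sum_(0 <= k < N) cmod (reduce (g x) d k - reduce a d k) ^+ 2.
have -> : (fun x => nrm (fun k => reduce (g x) d k - reduce a d k)) = Num.sqrt \o S.
  by apply/funext => x; exact: E.
have S0 : S @ F --> (0 : R).
  have -> : 0 = \sum_(0 <= k < N) (0 : R) by rewrite big1.
  apply: cvgR_sum => k; have -> : 0 = 0 ^+ 2 :> R by rewrite expr0n.
  by apply: cvgR_X; apply/cvgC; exact: reduce_fin_cvg dN ga.
rewrite -(@sqrtr0 R); apply: continuous_cvg S0; exact: sqrt_continuous.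
Qed.
End filt.

Definition cutoff c N k : C := if (k < N)%N then c k else 0.

Lemma cutoff0 c N : forall j, (N <= j)%N -> cutoff c N j = 0.
Proof. by move=> j; rewrite /cutoff ltnNge => ->. Qed.

Lemma l2_cutoff c N : l2 (cutoff c N).
Proof. exact: (nsq_fin (@cutoff0 c N)).1. Qed.

Lemma nsq_cutoff c N : l2 c ->
  nsq (fun k => c k - cutoff c N k) <= nsq c - series (fun k => cmod (c k) ^+ 2) N.
Proof.
move=> lc; apply: nsq_le => n.
rewrite lerBrDr; apply: le_trans (nsq_ub (N + n) lc).
have [nN|Nn] := leqP n N.
  rewrite {1}/series/= sum_lt_eq0 ?add0r.
    by apply: series_nsq_nd; rewrite leq_addr.
  by move=> i iN; rewrite /cutoff (leq_trans iN nN) subrr cmod0 expr0n.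
apply: (@le_trans _ _ (series (fun k => cmod (c k) ^+ 2) n)); last first.
  by apply: series_nsq_nd; rewrite leq_addl.
rewrite /series/= [X in X + _](big_cat_nat (leq0n N) (ltnW Nn))/=.
rewrite [X in X + _ + _]sum_lt_eq0 ?add0r; last first.
  by move=> i iN; rewrite /cutoff iN subrr cmod0 expr0n.
rewrite [leRHS](big_cat_nat (leq0n N) (ltnW Nn))/= [leLHS]addrC lerD2l.
rewrite big_nat_cond [leRHS]big_nat_cond ler_sum// => i; rewrite andbT => /andP[Ni _].
by rewrite cutoff0// subr0.
Qed.

Lemma cutoff_approx c (e : R) : l2 c -> 0 < e ->
  exists N, nrm (fun k => c k - cutoff c N k) < e.
Proof.
move=> lc e0; have e20 : 0 < e ^+ 2 by rewrite exprn_gt0.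
have /cvgrPdist_lt/(_ _ e20)[N _ /(_ N (leqnn N))] := nsqP lc.
rewrite ger0_norm ?subr_ge0 ?nsq_ub// => h; exists N.
rewrite -ltr_sqr ?nnegrE ?nrm_ge0 ?(ltW e0)// sqr_nrm.
exact: le_lt_trans (nsq_cutoff N lc) h.
Qed.

Lemma reduce_nrm_le c a : l2 c -> cmod a <= 1 -> nrm (reduce a c) <= nrm c.
Proof.
move=> lc a1; rewrite ler_wsqrtr// (reduce_nsq lc a1).2 gerBl mulr_ge0 ?sqr_ge0//.
by rewrite subr_ge0 expr_le1// cmod_ge0.
Qed.

(** For the finite sequence [cutoff c N] the coefficients of the reduced sequence
are polynomials in [a] and [conj a], including on the unit circle.  The error
made by the cutoff is not increased by the contractions [reduce a], uniformly in
[a]. *)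
Lemma reduce_cont T (F : set_system T) (FF : Filter F) (g : T -> C) a c :
  l2 c -> cmod a <= 1 -> (\forall x \near F, cmod (g x) <= 1) ->
  g @ F --> a -> (fun x => nrm (fun k => reduce (g x) c k - reduce a c k)) @ F --> (0 : R).
Proof.
move=> lc a1 g1 ga; apply/cvgrPdist_lt => e e0.
have e3 : 0 < e / 3 by rewrite divr_gt0.
have [N HN] := cutoff_approx lc e3.
have H0 : (fun x => nrm (fun k => reduce (g x) (cutoff c N) k - reduce a (cutoff c N) k)) @ F --> (0 : R).
  exact: reduce_fin_nrm (@cutoff0 c N) ga.
move/cvgrPdist_lt : H0 => /(_ _ e3) H.
near=> x.
have gx : cmod (g x) <= 1 by near: x.
have hx : nrm (fun k => reduce (g x) (cutoff c N) k - reduce a (cutoff c N) k) < e / 3.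
  have : `|0 - nrm (fun k => reduce (g x) (cutoff c N) k - reduce a (cutoff c N) k)| < e / 3.
    by near: x.
  by rewrite sub0r normrN ger0_norm ?nrm_ge0.
rewrite sub0r normrN ger0_norm ?nrm_ge0//.
have lt := @l2_cutoff c N.
have [l1 _] := reduce_nsq lc gx; have [l3 _] := reduce_nsq lc a1.
have [l4 _] := reduce_nsq lt gx; have [l5 _] := reduce_nsq lt a1.
apply: (le_lt_trans (nrm_subC l1 l4 l3)).
apply: (le_lt_trans (lerD (lexx _) (nrm_subC l4 l5 l3))).
have h1 : nrm (fun k => reduce (g x) c k - reduce (g x) (cutoff c N) k) < e / 3.
  by rewrite -reduce_sub//; apply: le_lt_trans HN; apply: reduce_nrm_le => //; exact: l2B.
have h2 : nrm (fun k => reduce a (cutoff c N) k - reduce a c k) < e / 3.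
  by rewrite nrmBC -reduce_sub//; apply: le_lt_trans HN; apply: reduce_nrm_le => //; exact: l2B.
have -> : e = e / 3 + (e / 3 + e / 3) by field.
exact: ltrD h1 (ltrD hx h2).
Unshelve. all: by end_near. Qed.

Definition reduces (s : seq C) c := foldl (fun d a => reduce a d) c s.
Definition cdisc (s : seq C) := all (fun a => cmod a <= 1) s.
Definition odisc (s : seq C) := all (fun a => cmod a < 1) s.

Lemma odisc_cdisc s : odisc s -> cdisc s.
Proof. by apply: sub_all => a /ltW. Qed.

Lemma reduces_l2 s c : cdisc s -> l2 c -> l2 (reduces s c).
Proof.
by elim: s c => //= a s IH c /andP[a1 s1] lc; apply: IH => //; exact: (reduce_nsq lc a1).1.
Qed.

Lemma reduces_nrm s c : cdisc s -> l2 c -> nrm (reduces s c) <= nrm c.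
Proof.
elim: s c => //= a s IH c /andP[a1 s1] lc; apply: le_trans (reduce_nrm_le lc a1).
by apply: IH => //; exact: (reduce_nsq lc a1).1.
Qed.

Lemma reduces_sub s c d : cdisc s -> l2 c -> l2 d ->
  reduces s (fun k => c k - d k) = (fun k => reduces s c k - reduces s d k).
Proof.
elim: s c d => //= a s IH c d /andP[a1 s1] lc ld.
by rewrite reduce_sub// IH//; [exact: (reduce_nsq lc a1).1|exact: (reduce_nsq ld a1).1].
Qed.

Lemma reduces_scal s c (w : C) : cdisc s -> l2 c ->
  reduces s (fun k => w * c k) = (fun k => w * reduces s c k).
Proof.
elim: s c => //= a s IH c /andP[a1 s1] lc.
by rewrite reduce_scal// IH//; exact: (reduce_nsq lc a1).1.
Qed.

Definition pt (p : R * R) : C := Complex p.1 p.2.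
Definition pdisc : set (R * R) := [set p | cmod (pt p) <= 1].

Lemma pt_cvg (q : R * R) : pt p @[p --> q] --> pt q.
Proof. by apply/cvgC_split; split; [exact: cvg_fst|exact: cvg_snd]. Qed.

Lemma compact_pdisc : compact pdisc.
Proof.
have H : compact (`[-1, 1]%classic `*` `[-1, 1]%classic : set (R * R)).
  by apply: compact_setX; exact: segment_compact.
apply: (subclosed_compact _ H).
  have -> : pdisc = (fun p => cmod (pt p)) @^-1` [set x | x <= 1] by [].
  apply: closed_comp; last exact: closed_le.
  move=> p _; have /cvgC := @pt_cvg p => h.
  apply/cvgrPdist_lt => e e0; move/cvgrPdist_lt : h => /(_ _ e0) h.
  near=> q; have : `|0 - cmod (pt q - pt p)| < e by near: q.
  rewrite sub0r normrN ger0_norm ?cmod_ge0// => hq.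
  rewrite ltr_norml; apply/andP; split.
    by rewrite ltrNl opprB (le_lt_trans (cmodB _ _)).
  by rewrite (le_lt_trans (cmodB _ _))// cmodBC.
move=> [x y]; rewrite /pdisc/= => h; split; rewrite /= in_itv/= -ler_norml.
  exact: le_trans (ler_Re (Complex x y)) h.
exact: le_trans (ler_Im (Complex x y)) h.
Unshelve. all: by end_near. Qed.

(** Induction on [n], which needs compactness of a single closed disc only: the
minimum [V d] over the remaining [n] parameters is 1-Lipschitz in the sequence
[d], because [reduces s] is a linear contraction, so [a |-> V (reduce a c)] is
continuous. *)
Lemma min_exists n c : l2 c -> exists s, [/\ size s = n, cdisc s &
  forall s', size s' = n -> cdisc s' -> nrm (reduces s c) <= nrm (reduces s' c)].
Proof.
elim: n c => [|n IH] c lc.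
  by exists [::]; split=> // s'; case: s'.
have [S HS] : exists S : (nat -> C) -> seq C, forall d, l2 d ->
   [/\ size (S d) = n, cdisc (S d) &
  forall s', size s' = n -> cdisc s' -> nrm (reduces (S d) d) <= nrm (reduces s' d)].
  have /choice[S HS] : forall d, exists s, l2 d -> [/\ size s = n, cdisc s &
    forall s', size s' = n -> cdisc s' -> nrm (reduces s d) <= nrm (reduces s' d)].
    move=> d; have [ld|nd] := pselect (l2 d); last by exists [::].
    by have [s Hs] := IH d ld; exists s.
  by exists S.
pose V d := nrm (reduces (S d) d).
have VL d e : l2 d -> l2 e -> V d - V e <= nrm (fun k => d k - e k).
  move=> ld le; have [Sd1 Sd2 Sd3] := HS d ld; have [Se1 Se2 Se3] := HS e le.
  apply: (@le_trans _ _ (nrm (reduces (S e) d) - nrm (reduces (S e) e))).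
    by rewrite lerD2r; exact: Sd3.
  apply: le_trans (nrm_dist _ _) _; [exact: reduces_l2|exact: reduces_l2|].
  by rewrite -reduces_sub//; apply: reduces_nrm => //; exact: l2B.
have [||p /set_mem Dp pmin] :=
  @compact_EVT_min _ R (fun p => V (reduce (pt p) c)) pdisc _ compact_pdisc.
- exists (0, 0); have -> : pdisc (0, 0) = (cmod (0 : C) <= 1) by [].
  by rewrite cmod0 ler01.
- apply/subspace_continuousP => q Dq; apply/cvgrPdist_lt => e e0.
  have Fq : (fun p => pt p) @ within pdisc (nbhs q) --> pt q.
    by apply: cvg_within_filter; exact: pt_cvg.
  have near1 : \forall x \near within pdisc (nbhs q), cmod (pt x) <= 1.
    by exact: withinT.
  have H0 : (fun p => nrm (fun k => reduce (pt p) c k - reduce (pt q) c k))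
     @ within pdisc (nbhs q) --> (0 : R) by exact: reduce_cont.
  move/cvgrPdist_lt : H0 => /(_ _ e0) H.
  near=> x.
  have Dx : cmod (pt x) <= 1 by near: x.
  have : `|0 - nrm (fun k => reduce (pt x) c k - reduce (pt q) c k)| < e by near: x.
  rewrite sub0r normrN ger0_norm ?nrm_ge0// => hx.
  have [lx _] := reduce_nsq lc Dx; have [lq _] := reduce_nsq lc Dq.
  rewrite ltr_norml; apply/andP; split.
    by rewrite ltrNl opprB; exact: le_lt_trans (VL _ _ lx lq) hx.
  by apply: le_lt_trans (VL _ _ lq lx) _; rewrite nrmBC.
have [lp _] := reduce_nsq lc Dp; have [Sp1 Sp2 Sp3] := HS _ lp.
exists (pt p :: S (reduce (pt p) c)); split => /=.
- by rewrite Sp1.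
- by apply/andP; split.
- case=> // a s [sn] /andP[a1 s1].
  have pa : pt (complex.Re a, complex.Im a) = a by case: a {a1}.
  have h : V (reduce (pt p) c) <= V (reduce a c).
    have := pmin (complex.Re a, complex.Im a); rewrite pa; apply.
    by apply/mem_set; rewrite /pdisc/= pa.
  apply: le_trans h _.
  by have [la _] := reduce_nsq lc a1; have [_ _] := HS _ la; apply.
Unshelve. all: by end_near. Qed.

Lemma reduces_filter s c : cdisc s -> l2 c ->
  nsq (reduces s c) = nsq (reduces [seq a <- s | cmod a < 1] c).
Proof.
elim: s c => //= a s IH c /andP[a1 s1] lc.
have [la _] := reduce_nsq lc a1.
have [alt|age] := boolP (cmod a < 1); first by rewrite /= IH.
have ae : cmod a = 1 by apply/eqP; rewrite eq_le a1 leNgt.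
have -> : reduce a c = (fun k => - conjc a * c k).
  by apply/funext => k; rewrite reduce_unimod.
rewrite reduces_scal// nsqZ; last exact: reduces_l2.
by rewrite cmodN cmodJ ae expr1n mul1r IH.
Qed.

(** One further step at a point where the remainder does not vanish lowers the
norm; the list is then padded with the parameter [1], which leaves the norm
unchanged. *)
Lemma improve c t n : l2 c -> odisc t -> (size t < n)%N ->
  (exists k, reduces t c k != 0) ->
  exists s, [/\ size s = n, cdisc s & nsq (reduces s c) < nsq (reduces t c)].
Proof.
move=> lc t1 tn hne; have ct := odisc_cdisc t1.
have [a [a1 ha]] := psum_neq0 (reduces_l2 ct lc) hne.
exists (t ++ a :: nseq (n - (size t).+1) 1); split.
- by rewrite size_cat/= size_nseq addnS -addSn subnKC.
- rewrite /cdisc all_cat; apply/andP; split => //=.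
  by rewrite ltW//= all_nseq cmod1 lexx orbT.
- rewrite {1}/reduces foldl_cat -/(reduces t c) -/(reduces _ (reduces t c)) reduces_filter; last 2 first.
  + by rewrite /cdisc/= ltW//= all_nseq cmod1 lexx orbT.
  + exact: reduces_l2.
  rewrite /= a1 (_ : [seq _ <- nseq _ _ | _] = [::])/=; last first.
    by apply/eqP; rewrite -size_eq0 size_filter count_nseq/= cmod1 ltxx.
  rewrite (reduce_nsq (reduces_l2 ct lc) (ltW a1)).2 gtrBl mulr_gt0//.
    by rewrite subr_gt0 expr_lt1// cmod_ge0.
  by rewrite exprn_gt0// lt_def cmod_eq0 ha cmod_ge0.
Qed.

(** A minimiser over the closed polydisc lies in the open one and has a nonzero
last coefficient; otherwise [improve] would beat it. *)
Lemma l2_best c n : l2 c ->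
  (forall t, odisc t -> (size t < n.+1)%N -> exists k, reduces t c k != 0) ->
  exists t a, [/\ size t = n, odisc t, cmod a < 1, psum (reduces t c) a != 0 &
    forall s', size s' = n.+1 -> cdisc s' -> nsq (reduces (rcons t a) c) <= nsq (reduces s' c)].
Proof.
move=> lc hne; have [s [sn s1 smin]] := min_exists n.+1 lc.
have {}smin s' : size s' = n.+1 -> cdisc s' -> nsq (reduces s c) <= nsq (reduces s' c).
  move=> sn' s1'; rewrite -!sqr_nrm ler_sqr ?nnegrE ?nrm_ge0//; exact: smin.
have os : odisc s.
  set t := [seq a <- s | cmod a < 1].
  have ot : odisc t by rewrite /odisc filter_all.
  have [st|st] := ltnP (size t) n.+1.
    have [s' [s'n s'1 lt]] := improve lc ot st (hne _ ot st).
    by have := smin _ s'n s'1; rewrite reduces_filter// leNgt lt.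
  rewrite /odisc all_count; apply/eqP/anti_leq; rewrite count_size/= sn.
  by rewrite -size_filter.
case/lastP : s sn s1 smin os => [//|t a]; rewrite size_rcons => -[tn] s1 smin.
rewrite /odisc all_rcons => /andP[a1 ot].
have ct := odisc_cdisc ot.
exists t, a; split => //; apply/negP => /eqP pz.
have tn1 : (size t < n.+1)%N by rewrite tn.
have [s' [s'n s'1 lt]] := improve lc ot tn1 (hne _ ot tn1).
have := smin s' s'n s'1; rewrite leNgt => /negP; apply.
suff -> : nsq (reduces (rcons t a) c) = nsq (reduces t c) by [].
rewrite /reduces foldl_rcons -/(reduces t c).
by rewrite (reduce_nsq (reduces_l2 ct lc) (ltW a1)).2 pz cmod0 expr0n/= mulr0 subr0.
Qed.

End Cont.

(** * Integrals over the unit circle *)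

Section Circle.
Context {R : realType}.
Local Notation C := R[i].
Local Notation mu := (@lebesgue_measure R).
Local Notation Iv x := (`[x, x + 2 * pi]%classic).
Implicit Types (x s t : R) (z : C) (g : {poly C}) (h : R -> C).

Definition cis t : C := Complex (cos t) (sin t).

Lemma cmod_cis t : cmod (cis t) = 1.
Proof.
apply/eqP; rewrite -(@eqrXn2 _ 2)// ?cmod_ge0//.
by rewrite sqr_cmod/= cos2Dsin2 expr1n.
Qed.

Lemma cis_continuous : continuous cis.
Proof.
by move=> t; apply/cvgC_split; split; [exact: continuous_cos|exact: continuous_sin].
Qed.

Lemma mulJcis t : conjc (cis t) * cis t = 1.
Proof. by rewrite mulrC mulcJ cmod_cis expr1n. Qed.

Lemma cis_expE t n : cis t ^+ n = Complex (cos (n%:R * t)) (sin (n%:R * t)).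
Proof.
elim: n => [|n IH]; first by rewrite mul0r cos0 sin0.
rewrite exprSr IH /cis; simpc; rewrite -natr1 mulrDl mul1r cosD sinD.
by congr Complex; ring.
Qed.

(** By the mean value theorem [sin (x/2) >= (x/2) cos (x/2)], whence
[sin x >= x cos^2 (x/2) = x (1 + cos x) / 2]. *)
Lemma sin_lb x : 0 <= x -> x <= pi / 2 -> x / 2 <= sin x.
Proof.
move=> x0 xpi; have pi0 := pi_gt0 R.
have x20 : 0 <= x / 2 by lra.
have [c] := @MVT_segment R sin cos 0 (x / 2) x20
  (fun y _ => is_derive_sin y) (continuous_subspaceT (@continuous_sin R)).
rewrite in_itv/= sin0 !subr0 => /andP[c0 cx] Es.
have Ex : x = (x / 2) *+ 2 by rewrite -mulr_natr divfK.
have cc : cos (x / 2) <= cos c.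
  move: cx; rewrite le_eqVlt => /predU1P[->//|cx].
  by rewrite ltW// ltr_cos// in_itv/=; lra.
have c2 : 0 <= cos (x / 2) by apply: cos_ge0_pihalf; lra.
rewrite {2}Ex sin_mulr2n Es.
have Ec : cos x = cos (x / 2) ^+ 2 *+ 2 - 1 by rewrite -cos_mulr2n -Ex.
have : 0 <= cos x by apply: cos_ge0_pihalf; lra.
rewrite Ec => h.
have key := ler_wpM2l c2 (ler_wpM2r x20 cc).
have key2 := mulr_ge0 h x20.
move: key key2; set y := x / 2; set a := cos y; set b := cos c.
move: y a b => y a b k1 k2; lra.
Qed.

Lemma cis_dist s t : `|s - t| <= pi -> `|s - t| / 2 <= cmod (cis s - cis t).
Proof.
move=> st; have pi0 := pi_gt0 R.
have E : cmod (cis s - cis t) ^+ 2 = (2 * sin (`|s - t| / 2)) ^+ 2.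
  have E1 : cmod (cis s - cis t) ^+ 2 = 2 - 2 * cos (s - t).
    rewrite sqr_cmod /cis/= cosB.
    have h1 := cos2Dsin2 s; have h2 := cos2Dsin2 t.
    move: (cos s) (sin s) (cos t) (sin t) h1 h2 => a b c d h1 h2.
    have -> : (a - c) ^+ 2 + (b - d) ^+ 2 = (a ^+ 2 + b ^+ 2) + (c ^+ 2 + d ^+ 2) -
      2 * (a * c + b * d) by ring.
    by rewrite h1 h2.
  rewrite E1; have -> : cos (s - t) = cos (`|s - t|).
    by case: (ger0P (s - t)) => //; rewrite cosN.
  have {1}-> : `|s - t| = (`|s - t| / 2) *+ 2 by rewrite -mulr_natr divfK.
  by rewrite cos_mulr2n cos2sin2; ring.
have u0 : 0 <= `|s - t| / 2 by rewrite divr_ge0.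
have := sin_lb u0; move=> /(_ _)/wrap[|h]; first lra.
rewrite (_ : cmod (cis s - cis t) = 2 * sin (`|s - t| / 2)); first lra.
apply/eqP; rewrite -(@eqrXn2 _ 2)// ?cmod_ge0 ?E//.
by rewrite mulr_ge0//; lra.
Qed.

(** The interval starts at an arbitrary [x]: the maximal function at [t] calls for
the period centred at [t]. *)
Definition cint x h : C :=
  Complex (\int[mu]_(s in Iv x) complex.Re (h s)) (\int[mu]_(s in Iv x) complex.Im (h s)).

Lemma contRe h : continuous h -> continuous (fun s => complex.Re (h s)).
Proof. by move=> ch s; have /cvgC_split[] := ch s. Qed.
Lemma contIm h : continuous h -> continuous (fun s => complex.Im (h s)).
Proof. by move=> ch s; have /cvgC_split[] := ch s. Qed.

Lemma cont_integrable (f : R -> R) x y : continuous f ->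
  mu.-integrable `[x, y] (EFin \o f).
Proof.
move=> cf; apply: continuous_compact_integrable; first exact: segment_compact.
exact: continuous_subspaceT.
Qed.

Lemma cintD x h k : continuous h -> continuous k ->
  cint x (fun s => h s + k s) = cint x h + cint x k.
Proof.
move=> ch ck; rewrite /cint; simpc; congr Complex.
  rewrite -RintegralD//; [|by apply: cont_integrable; exact: contRe|by apply: cont_integrable; exact: contRe].
  by apply: eq_Rintegral => s _; rewrite raddfD.
rewrite -RintegralD//; [|by apply: cont_integrable; exact: contIm|by apply: cont_integrable; exact: contIm].
by apply: eq_Rintegral => s _; rewrite raddfD.
Qed.

Lemma cintZ x (a : C) h : continuous h -> cint x (fun s => a * h s) = a * cint x h.
Proof.
move=> ch; case: a => a1 a2; rewrite /cint.
have i1 := cont_integrable x (x + 2 * pi) (contRe ch).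
have i2 := cont_integrable x (x + 2 * pi) (contIm ch).
have ZR b : mu.-integrable (Iv x) (EFin \o (fun s => b * complex.Re (h s))).
  by apply: cont_integrable => s; apply: cvgMr; exact: (contRe ch).
have ZI b : mu.-integrable (Iv x) (EFin \o (fun s => b * complex.Im (h s))).
  by apply: cont_integrable => s; apply: cvgMr; exact: (contIm ch).
simpc; congr Complex; rewrite -!RintegralZl// -?RintegralD// -?RintegralB//;
  by apply: eq_Rintegral => s _; case: (h s).
Qed.

Lemma cint_conj x h : continuous h -> cint x (fun s => conjc (h s)) = conjc (cint x h).
Proof.
move=> ch; rewrite /cint/=; congr Complex.
  by apply: eq_Rintegral => s _; case: (h s).
rewrite -mulN1r -RintegralZl//; last by apply: cont_integrable; exact: contIm.
by apply: eq_Rintegral => s _; rewrite mulN1r; case: (h s).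
Qed.

Lemma cint_sum x (I : Type) (r : seq I) (F : I -> R -> C) :
  (forall i, continuous (F i)) ->
  cint x (fun s => \sum_(i <- r) F i s) = \sum_(i <- r) cint x (F i).
Proof.
move=> cF; elim: r => [|i r IH].
  rewrite big_nil /cint; congr Complex; under eq_Rintegral do rewrite big_nil/=;
  by rewrite Rintegral_cst// mul0r.
rewrite big_cons -IH -cintD//; last by move=> s; apply: cvgC_sum => j; exact: cF.
by congr cint; apply/funext => s; rewrite big_cons.
Qed.

Lemma eq_cint x h k : h =1 k -> cint x h = cint x k.
Proof. by move=> /funext ->. Qed.

Lemma Rint_FTC (f F : R -> R) x y : x < y -> continuous f ->
  (forall s, is_derive s 1 F (f s)) -> \int[mu]_(s in `[x, y]) f s = F y - F x.
Proof.
move=> xy cf dF; have cF : continuous F.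
  by move=> s; apply/differentiable_continuous/derivable1_diffP; case: (dF s).
rewrite /Rintegral (@continuous_FTC2 _ f F)//.
- exact: continuous_subspaceT.
- split=> [s _||]; first by case: (dF s).
  + by apply: cvg_at_right_filter; exact: cF.
  + by apply: cvg_at_left_filter; exact: cF.
- by move=> s _; rewrite derive1E; case: (dF s).
Qed.

Lemma lt_Iv x : x < x + 2 * pi.
Proof. by rewrite ltrDl mulr_gt0// pi_gt0. Qed.

Lemma cis_X_continuous n : continuous (fun s => cis s ^+ n).
Proof. by move=> s; apply: cvgC_X; exact: cis_continuous. Qed.

Lemma cint_cisX x n : cint x (fun s => cis s ^+ n) = if n == 0%N then (2 * pi)%:C else 0.
Proof.
case: n => [|n]/=.
  rewrite /cint; under eq_Rintegral do rewrite expr0/=.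
  under [in X in Complex _ X]eq_Rintegral do rewrite expr0/=.
  rewrite !Rintegral_cst//= lebesgue_measure_itv/= lte_fin lt_Iv -EFinD/=.
  by rewrite mul0r mul1r addrC addKr.
have n0 : (n.+1%:R : R) != 0 by rewrite pnatr_eq0.
have per : n.+1%:R * (x + 2 * pi) = n.+1%:R * x + (n.+1 * 2)%:R * pi :> R.
  by rewrite natrM; ring.
have perc : forall m, cos (n.+1%:R * x + (m * 2)%:R * pi) = cos (n.+1%:R * x) :> R.
  elim=> [|m IH]; first by rewrite mul0n mul0r addr0.
  rewrite -IH -[in RHS]cosD2pi; congr cos.
  by rewrite mulSn natrD -mulr_natr; ring.
have pers : forall m, sin (n.+1%:R * x + (m * 2)%:R * pi) = sin (n.+1%:R * x) :> R.
  elim=> [|m IH]; first by rewrite mul0n mul0r addr0.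
  rewrite -IH -[in RHS]sinD2pi; congr sin.
  by rewrite mulSn natrD -mulr_natr; ring.
rewrite /cint; apply/eqP; rewrite eq_complex/=; apply/andP; split; apply/eqP.
- have D s : is_derive s 1 (fun s => n.+1%:R^-1 * sin (n.+1%:R * s)) (complex.Re (cis s ^+ n.+1)).
    rewrite cis_expE/=; apply: is_derive_eq.
    by rewrite /GRing.scale/= mulr1 mulrC -mulrA divff ?mulr1.
  rewrite (Rint_FTC (lt_Iv x) _ D); last exact/contRe/cis_X_continuous.
  by rewrite per pers subrr.
- have D s : is_derive s 1 (fun s => - n.+1%:R^-1 * cos (n.+1%:R * s)) (complex.Im (cis s ^+ n.+1)).
    rewrite cis_expE/=; apply: is_derive_eq.
    by rewrite /GRing.scale/= mulr1; field.
  rewrite (Rint_FTC (lt_Iv x) _ D); last exact/contIm/cis_X_continuous.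
  by rewrite per perc subrr.
Qed.

End Circle.
#[global] Arguments cint : simpl never.

(** * The Poisson kernel and the Parseval identity for polynomials *)

Section Poisson.
Context {R : realType}.
Local Notation C := R[i].
Local Notation mu := (@lebesgue_measure R).
Local Notation Iv x := (`[x, x + 2 * pi]%classic).
Implicit Types (x s t : R) (z : C) (g : {poly C}) (h : R -> C).

Lemma cvg_cmod T (F : set_system T) (FF : Filter F) (f : T -> C) (l : C) :
  f @ F --> l -> (fun p => cmod (f p)) @ F --> cmod l.
Proof.
move=> /cvgC /cvgrPdist_lt H; apply/cvgrPdist_lt => d d0; near=> p.
have : `|0 - cmod (f p - l)| < d by near: p; exact: H.
rewrite sub0r normrN ger0_norm ?cmod_ge0// => h.
rewrite ltr_norml; apply/andP; split.
  by rewrite ltrNl opprB (le_lt_trans (cmodB _ _)).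
by rewrite (le_lt_trans (cmodB _ _))// cmodBC.
Unshelve. all: by end_near. Qed.

Lemma cmod_cont h : continuous h -> continuous (fun s => cmod (h s)).
Proof. by move=> ch s; apply: cvg_cmod; exact: ch. Qed.

Lemma real_complex_cont (f : R -> R) : continuous f -> continuous (fun s => (f s)%:C : C).
Proof.
move=> cf s; apply/cvgC_split; split; [exact: cf|exact: cvg_cst].
Qed.

Lemma ger0_Rint_le x (f G : R -> R) : continuous f -> continuous G ->
  (forall s, `|f s| <= G s) ->
  `| \int[mu]_(s in Iv x) f s | <= \int[mu]_(s in Iv x) G s.
Proof.
move=> cf cG fG.
have i1 := cont_integrable x (x + 2 * pi) cf.
have i2 := cont_integrable x (x + 2 * pi) cG.
apply: le_trans (le_normr_Rintegral _ i1) _ => //.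
apply: le_Rintegral => //.
by apply: cont_integrable => s; apply: cvg_norm; exact: cf.
Qed.

Lemma cint_le x h (G : R -> R) : continuous h -> continuous G ->
  (forall s, cmod (h s) <= G s) -> cmod (cint x h) <= 2 * \int[mu]_(s in Iv x) G s.
Proof.
move=> ch cG hG; rewrite (le_trans (cmod_leD _))// mulrDl mul1r lerD//=.
  by apply: ger0_Rint_le => // [|s]; [exact: contRe|exact: le_trans (ler_Re _) (hG s)].
by apply: ger0_Rint_le => // [|s]; [exact: contIm|exact: le_trans (ler_Im _) (hG s)].
Qed.

Lemma le_geo_le0 (y B r : R) : 0 <= r -> r < 1 -> (forall m, y <= B * r ^+ m) -> y <= 0.
Proof.
move=> r0 r1 H.
have c0 : (fun m => B * r ^+ m) @ \oo --> (0 : R).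
  rewrite -[X in _ --> X](mulr0 B); apply: cvgMr.
  by apply: cvg_expr; rewrite ger0_norm.
have <- : limn (fun m => B * r ^+ m) = 0 by apply: cvg_lim.
by apply: limr_ge; [apply: cvgP c0|apply: nearW].
Qed.

Section kernel.
Variables (z : C) (z1 : cmod z < 1).

Definition cauchy_den s : C := 1 - conjc z * cis s.

Lemma cauchy_den_lb s : 1 - cmod z <= cmod (cauchy_den s).
Proof.
by rewrite -[leLHS](_ : cmod 1 - cmod (conjc z * cis s) = _) ?cmodB// cmod1 cmodM cmodJ cmod_cis mulr1.
Qed.

Lemma cauchy_den_neq0 s : cauchy_den s != 0.
Proof.
by rewrite -cmod_eq0 gt_eqF// (lt_le_trans _ (cauchy_den_lb s))// subr_gt0.
Qed.

Lemma cis_subE s : cis s - z = cis s * conjc (cauchy_den s).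
Proof.
rewrite /cauchy_den rmorphB rmorph1 rmorphM/= conjcK mulrBr mulr1 mulrCA.
by rewrite [cis s * _]mulrC mulJcis mulr1.
Qed.

Lemma cmod_cauchy_den s : cmod (cauchy_den s) = cmod (cis s - z).
Proof. by rewrite cis_subE cmodM cmod_cis mul1r cmodJ. Qed.

Lemma cauchy_den_cont : continuous cauchy_den.
Proof.
move=> s; apply: cvgB; first exact: cvg_cst.
by apply: cvgMr; exact: cis_continuous.
Qed.

Let K s := (cauchy_den s)^-1.
Let K_cont : continuous K.
Proof. by move=> s; apply: cvgV; [exact: cauchy_den_neq0|exact: cauchy_den_cont]. Qed.

Let eK k s := cis s ^+ k * K s.
Let eK_cont k : continuous (eK k).
Proof. by move=> s; apply: cvgM; [exact: cis_X_continuous|exact: K_cont]. Qed.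

Let cintK_rec x k : cint x (eK k) = cint x (fun s => cis s ^+ k) + conjc z * cint x (eK k.+1).
Proof.
rewrite -cintZ; last exact: eK_cont.
rewrite -cintD; [|exact: cis_X_continuous|by move=> s; apply: cvgMr; exact: eK_cont].
apply: eq_cint => s; rewrite /eK /K exprSr.
have := cauchy_den_neq0 s; rewrite /cauchy_den; move: (cis s ^+ k) (cis s) (conjc z) => a b c h.
by field.
Qed.

Let cintK_bound x k : cmod (cint x (eK k)) <= 2 * \int[mu]_(s in Iv x) (1 - cmod z)^-1.
Proof.
apply: cint_le; [exact: eK_cont|by move=> s; exact: cvg_cst|move=> s].
have d1 : 0 < 1 - cmod z by rewrite subr_gt0.
have d2 := lt_le_trans d1 (cauchy_den_lb s).
by rewrite cmodM cmodX cmod_cis expr1n mul1r cmodV lef_pV2 ?cauchy_den_lb.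
Qed.

(** As [K = 1 + conj z e^{is} K], the integrals of [e^{iks} K] for [k >= 1] are
multiplied by [conj z] when [k] is lowered by one; they are bounded and
[|z| < 1], so they vanish. *)
Let cintK_S x k : cint x (eK k.+1) = 0.
Proof.
have H m : cint x (eK k.+1) = conjc z ^+ m * cint x (eK (m + k.+1)).
  elim: m => [|m ->]; first by rewrite mul1r.
  by rewrite (cintK_rec x (m + k.+1)) cint_cisX !(addnS, addSn)/= add0r mulrA -exprSr.
apply/eqP; rewrite -cmod_eq0 eq_le cmod_ge0 andbT.
apply: (@le_geo_le0 _ (2 * \int[mu]_(s in Iv x) (1 - cmod z)^-1) (cmod z)) => //.
  exact: cmod_ge0.
move=> m; rewrite (H m) cmodM cmodX cmodJ mulrC ler_wpM2r ?cintK_bound//.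
by rewrite exprn_ge0// cmod_ge0.
Qed.

Let cintK_0 x : cint x (eK 0) = (2 * pi)%:C.
Proof. by rewrite cintK_rec cint_cisX cintK_S mulr0 addr0. Qed.

Definition poisson s : R := (1 - cmod z ^+ 2) / cmod (cauchy_den s) ^+ 2.

Lemma poissonE s : (poisson s)%:C = (1 - z * conjc z) * (K s * conjc (K s)).
Proof.
rewrite /poisson !mulcJ rmorphM rmorphB/= rmorph1; congr (_ * _%:C).
by rewrite /K cmodV exprVn.
Qed.

Lemma poisson_cont : continuous poisson.
Proof.
move=> s; apply: cvgMr; apply: cvgV.
  by rewrite expf_neq0// cmod_eq0 cauchy_den_neq0.
by apply: cvgR_X; apply: cmod_cont; exact: cauchy_den_cont.
Qed.

Lemma poisson_ge0 s : 0 <= poisson s.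
Proof.
by rewrite divr_ge0 ?sqr_ge0// subr_ge0 expr_le1// ?cmod_ge0// ltW.
Qed.

Let eP k s := cis s ^+ k * (poisson s)%:C.
Let eP_cont k : continuous (eP k).
Proof.
move=> s; apply: cvgM; first exact: cis_X_continuous.
by apply: real_complex_cont; exact: poisson_cont.
Qed.

(** [(e^{is} - z) P = (1 - |z|^2) e^{is} K]: the factor [e^{is} - z] cancels the
conjugate Cauchy kernel. *)
Let cintP_S x k : cint x (eP k.+1) = z * cint x (eP k).
Proof.
apply/eqP; rewrite -subr_eq0 -mulNr -cintZ; last exact: eP_cont.
rewrite -cintD; [|exact: eP_cont|by move=> s; apply: cvgMr; exact: eP_cont].
have -> : cint x (fun s => eP k.+1 s + - z * eP k s) =
   cint x (fun s => (1 - z * conjc z) * eK k.+1 s).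
  apply: eq_cint => s; rewrite /eP poissonE /eK exprS mulNr -mulrA -mulrBl /K.
  rewrite cis_subE fmorphV/=.
  have := cauchy_den_neq0 s; have : conjc (cauchy_den s) != 0 by rewrite conjc_eq0 cauchy_den_neq0.
  by move: (cauchy_den s) (conjc (cauchy_den s)) => a b hb ha; field; apply/andP.
by rewrite (cintZ x (1 - z * conjc z) (eK_cont (k:=k.+1))) cintK_S mulr0.
Qed.

(** [P = K + conj K - 1]. *)
Let cintP_0 x : cint x (eP 0) = (2 * pi)%:C.
Proof.
have -> : cint x (eP 0) = cint x (fun s => (eK 0 s + conjc (eK 0 s)) + -1 * cis s ^+ 0).
  apply: eq_cint => s; rewrite /eP poissonE /eK /K !expr0 !mul1r mulr1 fmorphV/=.
  have h1 := cauchy_den_neq0 s.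
  have h2 : conjc (cauchy_den s) != 0 by rewrite conjc_eq0.
  have E : (cauchy_den s) * conjc (cauchy_den s) =
     cauchy_den s + conjc (cauchy_den s) - 1 + z * conjc z.
    have -> : conjc (cauchy_den s) = 1 - z * conjc (cis s).
      by rewrite /cauchy_den rmorphB rmorph1 rmorphM/= conjcK.
    rewrite /cauchy_den.
    have := mulJcis s; move: (cis s) (conjc (cis s)) (conjc z) => a b c h.
    have E2 : c * a * (z * b) = z * c * (b * a) by ring.
    have -> : z * c = c * a * (z * b) by rewrite E2 h mulr1.
    by ring.
  have -> : z * conjc z = cauchy_den s * conjc (cauchy_den s) -
      (cauchy_den s + conjc (cauchy_den s)) + 1 by rewrite E; ring.
  move: (cauchy_den s) (conjc (cauchy_den s)) h1 h2 => a b h1 h2.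
  by field; apply/andP.
have cc : continuous (fun s => conjc (eK 0 s)) by move=> s; apply: cvgC_conj; exact: eK_cont.
have c1 : continuous (fun s => eK 0 s + conjc (eK 0 s)).
  by move=> s; apply: cvgD; [exact: eK_cont|exact: cc].
have c2 : continuous (fun s => -1 * cis s ^+ 0 : C).
  by move=> s; apply: cvgMr; exact: cis_X_continuous.
rewrite (cintD x c1 c2) (cintD x (eK_cont (k:=0)) cc) (cintZ x (-1) (cis_X_continuous (n:=0))).
rewrite (cint_conj x (eK_cont (k:=0))) cintK_0 cint_cisX conjc_real.
by ring.
Qed.

Lemma poly_cis_cont g : continuous (fun s => g.[cis s]).
Proof.
have -> : (fun s => g.[cis s]) = (fun s => \sum_(i < size g) g`_i * cis s ^+ i).
  by apply/funext => s; rewrite horner_coef.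
by move=> s; apply: cvgC_sum => i; apply: cvgMr; exact: cis_X_continuous.
Qed.

Lemma poisson_formula x g :
  cint x (fun s => g.[cis s] * (poisson s)%:C) = (2 * pi)%:C * g.[z].
Proof.
have H k : cint x (eP k) = (2 * pi)%:C * z ^+ k.
  by elim: k => [|k IH]; rewrite ?cintP_0 ?mulr1// cintP_S IH exprS mulrCA.
have -> : (fun s => g.[cis s] * (poisson s)%:C) = (fun s => \sum_(i < size g) g`_i * eP i s).
  apply/funext => s; rewrite horner_coef mulr_suml; apply: eq_bigr => i _.
  by rewrite -mulrA.
rewrite cint_sum; last by move=> i s; apply: cvgMr; exact: eP_cont.
rewrite horner_coef mulr_sumr; apply: eq_bigr => i _.
by rewrite (cintZ x _ (eP_cont (k:=i))) H mulrCA.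
Qed.

(** The factor [pi] in place of [2 pi] pays for estimating the real and imaginary
parts of the integral separately. *)
Lemma poisson_bound x g :
  pi * cmod g.[z] <= \int[mu]_(s in Iv x) (cmod g.[cis s] * poisson s).
Proof.
have pi0 := pi_gt0 R.
rewrite -(@ler_pM2l _ 2)// mulrA.
have -> : 2 * pi * cmod g.[z] = cmod (cint x (fun s => g.[cis s] * (poisson s)%:C)).
  by rewrite poisson_formula cmodM cmod_real ger0_norm// mulr_ge0// ltW.
apply: cint_le.
- move=> s; apply: cvgM; [exact: poly_cis_cont|].
  by apply: real_complex_cont; exact: poisson_cont.
- move=> s; apply: cvgM; [|exact: poisson_cont].
  by apply: cmod_cont; exact: poly_cis_cont.
- by move=> s; rewrite cmodM cmod_real ger0_norm// poisson_ge0.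
Qed.

End kernel.

Lemma cint_cisJ x i j : cint x (fun s => cis s ^+ i * conjc (cis s ^+ j)) =
  if i == j then (2 * pi)%:C else 0.
Proof.
wlog ij : i j / (j <= i)%N => [H|].
  have [/H//|/ltnW ji] := leqP j i.
  rewrite eq_sym -(conjcK (cint _ _)) -cint_conj; last first.
    move=> s; apply: cvgM; first exact: cis_X_continuous.
    by apply: cvgC_conj; exact: cis_X_continuous.
  have -> : (fun s => conjc (cis s ^+ i * conjc (cis s ^+ j))) =
     (fun s => cis s ^+ j * conjc (cis s ^+ i)).
    by apply/funext => s; rewrite rmorphM/= conjcK mulrC.
  by rewrite H//; case: eqP => _; rewrite ?conjc_real ?conjc0.
have -> : (fun s : R => cis s ^+ i * conjc (cis s ^+ j)) = (fun s => cis s ^+ (i - j)).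
  apply/funext => s; rewrite -{1}(subnK ij) exprD -mulrA rmorphXn/= -exprMn.
  by rewrite [cis s * _]mulrC mulJcis expr1n mulr1.
by rewrite cint_cisX subn_eq0 eqn_leq ij andbT.
Qed.

Lemma poly_nsq g : l2 (fun k => g`_k) /\
  nsq (fun k => g`_k) = \sum_(i < size g) cmod g`_i ^+ 2.
Proof.
have [h1 h2] := @nsq_fin _ (fun k => g`_k) (size g) (fun j gj => nth_default 0 gj).
by rewrite h2 big_mkord.
Qed.

Lemma poly_parseval x g :
  \int[mu]_(s in Iv x) (cmod g.[cis s] ^+ 2) = 2 * pi * nsq (fun k => g`_k).
Proof.
have -> : \int[mu]_(s in Iv x) (cmod g.[cis s] ^+ 2) =
   complex.Re (cint x (fun s => g.[cis s] * conjc g.[cis s])).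
  by apply: eq_Rintegral => s _; rewrite mulcJ.
have -> : (fun s => g.[cis s] * conjc g.[cis s]) =
   (fun s => \sum_(i < size g) \sum_(j < size g)
        (g`_i * conjc g`_j) * (cis s ^+ i * conjc (cis s ^+ j))).
  apply/funext => s; rewrite horner_coef rmorph_sum/= mulr_suml; apply: eq_bigr => i _.
  by rewrite mulr_sumr; apply: eq_bigr => j _; rewrite rmorphM/=; ring.
have c1 i j : continuous (fun s : R => cis s ^+ i * conjc (cis s ^+ j)).
  move=> s; apply: cvgM; first exact: cis_X_continuous.
  by apply: cvgC_conj; exact: cis_X_continuous.
have c2 i j : continuous (fun s => (g`_i * conjc g`_j) * (cis s ^+ i * conjc (cis s ^+ j))).
  by move=> s; apply: cvgMr; exact: c1.
have c3 i : continuous (fun s => \sum_(j < size g)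
     (g`_i * conjc g`_j) * (cis s ^+ i * conjc (cis s ^+ j))).
  by move=> s; apply: cvgC_sum => j; exact: c2.
rewrite (cint_sum x _ (fun i : 'I_(size g) => c3 i)).
rewrite (poly_nsq g).2 raddf_sum mulr_sumr; apply: eq_bigr => i _.
rewrite (cint_sum x _ (fun j : 'I_(size g) => c2 i j)).
rewrite (bigD1 i)//= big1 ?addr0; last first.
  move=> j ji; rewrite (cintZ x _ (c1 i j)) cint_cisJ.
  by rewrite (inj_eq val_inj) eq_sym (negbTE ji) mulr0.
rewrite (cintZ x _ (c1 i i)) cint_cisJ eqxx mulcJ -rmorphM/=; ring.
Qed.

End Poisson.

(** * The non-tangential maximal inequality *)

Section Maximal.
Context {R : realType}.
Local Notation C := R[i].
Local Notation mu := (@lebesgue_measure R).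
Local Notation Iv x := (`[x, x + 2 * pi]%classic).
Implicit Types (x s t : R) (z : C) (g : {poly C}).

(** [2 (1 + M)] compares [max (1 - |z|, |s - t|)] with [|e^{is} - z|] on the
non-tangential region of aperture [M]. *)
Definition layer (M : R) : R := 8 * (2 * (1 + M)) ^+ 2.

(** Dyadic decomposition of the Poisson kernel around [t], at the scale [1 - |z|]:
on the [j]-th ball it is at most [4^-j / (1 - |z|)], up to a constant.  The
proof takes the smallest ball that contains [s]. *)
Lemma poisson_layer (M : R) t z s (J : nat) : 1 < M -> stolz M (cis t) z ->
  `|s - t| <= pi -> pi < 2 ^+ J * (1 - cmod z) ->
  exists2 j, (j < J.+1)%N & `|s - t| < 2 ^+ j * (1 - cmod z) /\
    poisson z s <= layer M * 4^-1 ^+ j / (1 - cmod z).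
Proof.
move=> M1 [z1 zt] st piJ; rewrite /unit_disc/= in z1.
set d := 1 - cmod z in zt piJ *; have d0 : 0 < d by rewrite subr_gt0.
set u := `|s - t| in st *; have u0 : 0 <= u by exact: normr_ge0.
set L := 2 * (1 + M); have L2 : 2 <= L by rewrite /L; lra.
pose D := cmod (cauchy_den z s).
have dD : d <= D := cauchy_den_lb z s.
have uD : u <= L * D.
  have h1 := cis_dist st.
  have h2 : cmod (cis s - cis t) <= D + cmod (cis t - z).
    rewrite /D cmod_cauchy_den -[X in cmod X <= _](subrKA z).
    by rewrite (le_trans (cmodD _ _))// [X in _ + X <= _]cmodBC.
  have h3 : M * d <= M * D by rewrite ler_wpM2l//; lra.
  by rewrite /L -/u in h1 *; lra.
have D0 : 0 < D by lra.
have PD m : 0 < m -> m <= L * D -> poisson z s <= 2 * L ^+ 2 * d / m ^+ 2.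
  move=> m0 mL; rewrite /poisson -/D.
  have h : 1 - cmod z ^+ 2 <= 2 * d.
    by rewrite /d; have := cmod_ge0 z; nra.
  rewrite ler_pdivrMr ?exprn_gt0// mulrAC ler_pdivlMr ?exprn_gt0//.
  have h2 : m ^+ 2 <= L ^+ 2 * D ^+ 2.
    by rewrite -exprMn ler_sqr ?nnegrE ?(ltW m0) ?mulr_ge0//; lra.
  apply: (@le_trans _ _ (2 * d * (L ^+ 2 * D ^+ 2))); last by rewrite le_eqVlt; apply/orP; left; apply/eqP; ring.
  by apply: ler_pM; rewrite ?sqr_ge0// subr_ge0 expr_le1// ?cmod_ge0 ?ltW.
have /ex_minnP[j uj jmin] : exists j, u < 2 ^+ j * d.
  by exists J; exact: le_lt_trans st piJ.
exists j; first by rewrite ltnS; apply: jmin; exact: le_lt_trans st piJ.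
split=> //; rewrite /layer -/L.
case: j uj jmin => [|j] uj jmin.
  apply: le_trans (PD d d0 _) _; first by nra.
  have -> : 2 * L ^+ 2 * d / d ^+ 2 = 2 * L ^+ 2 / d by field; rewrite gt_eqF.
  by rewrite expr0 mulr1 ler_pM2r ?invr_gt0// ler_wpM2r ?sqr_ge0//; lra.
have ju : 2 ^+ j * d <= u by rewrite leNgt; apply/negP => /jmin; rewrite ltnn.
have pj : 0 < 2 ^+ j :> R by rewrite exprn_gt0.
apply: le_trans (PD (2 ^+ j * d) (mulr_gt0 pj d0) (le_trans ju uD)) _.
have -> : 4^-1 ^+ j.+1 = (4 * (2 ^+ j) ^+ 2)^-1 :> R.
  by rewrite exprVn exprS -exprM mulnC exprM (_ : 2 ^+ 2 = 4 :> R)//; ring.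
rewrite le_eqVlt; apply/orP; left; apply/eqP; field.
by apply/andP; split; rewrite gt_eqF.
Qed.

Local Notation W := (`[- pi, 3 * pi]%classic).

(** The window [[- pi, 3 pi]] contains every period centred at a point of
[[0, 2 pi]]; restricting to it makes the function integrable on the line. *)
Definition bdry g : R -> R := (fun s => cmod g.[cis s]) \_ W.

Lemma cmod_poly_cont g : continuous (fun s => cmod g.[cis s]).
Proof. by apply: cmod_cont; exact: poly_cis_cont. Qed.

Lemma bdry_ge0 g s : 0 <= bdry g s.
Proof. by rewrite /bdry patchE; case: ifP => // _; exact: cmod_ge0. Qed.

Lemma bdry_loc g : locally_integrable setT (bdry g).
Proof.
apply: integrable_locally => //; apply: cont_integrable; exact: cmod_poly_cont.
Qed.

Lemma bdry_meas g : measurable_fun setT (bdry g).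
Proof. by have [] := bdry_loc g. Qed.

Lemma bdry_ball_le g t r (h : R) : 0 < r -> (HL_maximal (bdry g) t <= h%:E)%E ->
  (\int[mu]_(s in ball t r) (bdry g s)%:E <= (2 * r * h)%:E)%E.
Proof.
move=> r0 HL.
have : (iavg (bdry g) (ball t r) <= h%:E)%E.
  apply: le_trans HL; apply: ereal_sup_ubound; exists r => //.
  by rewrite /= in_itv/= andbT.
rewrite /iavg lebesgue_measure_ball ?(ltW r0)//.
rewrite inver mulrn_eq0/= gt_eqF// lee_pdivrMl; last by rewrite pmulrn_lgt0.
under eq_integral do rewrite ?abse_EFin ger0_norm ?bdry_ge0//.
by rewrite -EFinM -(mulr_natl r).
Qed.

(** The Poisson integral is bounded by a sum over dyadic balls around [t] of
radius [2^j (1 - |z|)].  The integral over each ball is at most its length times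
the maximal function, and the weights [4^-j 2^j] are summable. *)
Lemma nontangential_maximal (M : R) g t z (h : R) : 1 < M ->
  0 <= t <= 2 * pi -> stolz M (cis t) z -> 0 <= h -> (HL_maximal (bdry g) t <= h%:E)%E ->
  pi * cmod g.[z] <= 4 * layer M * h.
Proof.
move=> M1 /andP[t0 t1] zt h0 HL; have pi0 := pi_gt0 R.
have z1 : cmod z < 1 by case: zt.
set d := 1 - cmod z; have d0 : 0 < d by rewrite subr_gt0.
have L0 : 0 <= layer M by rewrite mulr_ge0// sqr_ge0.
have [J piJ] : exists J : nat, pi < 2 ^+ J * d.
  have [k /andP[_ hk]] : exists k : nat, true && (pi / d < k%:R).
    exists (Num.truncn (pi / d)).+1; rewrite /=.
    by rewrite truncnS_gt.
  exists k; rewrite -ltr_pdivrMr//; apply: lt_le_trans hk _.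
  by rewrite -natrX ler_nat ltnW// ltn_expl.
apply: (le_trans (poisson_bound z1 (t - pi) g)).
set I := `[t - pi, t - pi + 2 * pi]%classic.
have mI : measurable I by exact: measurable_itv.
have Ist s : I s -> `|s - t| <= pi.
  rewrite /I/= in_itv/= => /andP[h1 h2]; rewrite ler_norml; apply/andP; split; lra.
have IW s : I s -> W s.
  rewrite /I/= !in_itv/= => /andP[h1 h2]; apply/andP; split; lra.
pose a j : R := layer M * 4^-1 ^+ j / d.
have a0 j : 0 <= a j.
  by apply: divr_ge0 (ltW d0); apply: mulr_ge0 L0 _; apply: exprn_ge0; lra.
pose B j := ball t (2 ^+ j * d) : set R.
have B0 j : 0 < 2 ^+ j * d by rewrite mulr_gt0 ?exprn_gt0.
have mB j : measurable (B j) by exact: measurable_ball.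
pose G j s := ((a j)%:E * ((EFin \o bdry g) \_ (B j)) s)%E.
have G0 j s : (0 <= G j s)%E.
  rewrite mule_ge0 ?lee_fin// patchE; case: ifP => // _.
  by rewrite /= lee_fin bdry_ge0.
have mP j : measurable_fun setT ((EFin \o bdry g) \_ (B j)).
  apply/measurable_restrict => //.
  rewrite setTI; apply: measurable_funTS; apply/measurable_EFinP.
  exact: bdry_meas.
have mG j : measurable_fun setT (G j) by apply: measurable_funeM; exact: mP.
have key : (\int[mu]_(s in I) (cmod g.[cis s] * poisson z s)%:E <=
    (4 * layer M * h)%:E)%E.
  have cP : continuous (fun s => cmod g.[cis s] * poisson z s).
    move=> s; apply: cvgM; [exact: cmod_poly_cont|exact: poisson_cont].
  apply: (@le_trans _ _ (\int[mu]_(s in I) \sum_(j < J.+1) G j s)%E).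
    apply: ge0_le_integral => //.
    - by move=> s _; rewrite lee_fin mulr_ge0 ?cmod_ge0 ?poisson_ge0.
    - apply/measurable_EFinP; apply: measurable_funTS.
      exact: continuous_measurable_fun.
    - by apply: emeasurable_sum => j; apply: measurable_funTS; exact: mG.
    move=> s Is; have [j jJ [uj Pj]] := poisson_layer M1 zt (Ist s Is) piJ.
    rewrite (bigD1 (Ordinal jJ))//= -[leLHS]adde0; apply: leeD; last first.
      by apply: sume_ge0 => i _; exact: G0.
    rewrite /G patchE mem_set; last by rewrite /B /ball/= distrC.
    rewrite /= /bdry patchE mem_set; last exact: IW.
    by rewrite -EFinM lee_fin mulrC ler_wpM2r// cmod_ge0.
  apply: (@le_trans _ _ (\int[mu]_s \sum_(j < J.+1) G j s)%E).
    apply: ge0_subset_integral => //.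
    - by apply: emeasurable_sum => j; exact: mG.
    - by move=> s _; apply: sume_ge0 => j _; exact: G0.
  rewrite ge0_integral_sum//; last by move=> j; exact: mG.
  have Gj j : (\int[mu]_s G j s <= (2 * layer M * h * 2^-1 ^+ j)%:E)%E.
    have P0 s : [set: R] s -> (0 <= ((EFin \o bdry g) \_ (B j)) s)%E.
      by move=> _; rewrite patchE; case: ifP => // _; rewrite /= lee_fin; exact: bdry_ge0.
    rewrite /G (ge0_integralZl_EFin mu measurableT P0 (mP j) (a0 j)).
    rewrite -integral_mkcond.
    have hb := bdry_ball_le (B0 j) HL.
    apply: (@le_trans _ _ ((a j)%:E * (2 * (2 ^+ j * d) * h)%:E)%E).
      by apply: lee_wpmul2l => //; rewrite lee_fin.
    rewrite -EFinM lee_fin /a le_eqVlt; apply/orP; left; apply/eqP.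
    have -> : 4^-1 ^+ j = (2 ^+ j * 2 ^+ j)^-1 :> R.
      by rewrite exprVn -exprMn; congr (_ ^+ j)^-1; ring.
    rewrite exprVn; field.
    by apply/andP; split; rewrite gt_eqF// exprn_gt0.
  apply: (@le_trans _ _ (\sum_(j < J.+1) (2 * layer M * h * 2^-1 ^+ j)%:E)%E).
    by apply: lee_sum => j _; exact: Gj.
  rewrite sumEFin lee_fin -mulr_sumr.
  have hg : \sum_(j < J.+1) 2^-1 ^+ j <= 2 :> R.
    by rewrite -(big_mkord xpredT (fun j => 2^-1 ^+ j)) geo_half_le.
  apply: (@le_trans _ _ (2 * layer M * h * 2)); last by rewrite le_eqVlt; apply/orP; left; apply/eqP; ring.
  by apply: ler_wpM2l hg; apply: mulr_ge0 h0; apply: mulr_ge0 L0.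
rewrite /Rintegral -(@lee_fin R) fineK// ge0_fin_numE.
  by apply: le_lt_trans key _; exact: ltry.
by apply: integral_ge0 => s _; rewrite lee_fin mulr_ge0 ?cmod_ge0 ?poisson_ge0.
Qed.

(** Taking the square of the polynomial turns the weak-type inequality in [L^1]
into one that involves the norm in [L^2]: [|g^2| = |g|^2], and the window
consists of two periods. *)
Lemma maximal_weak g (c : R) : 0 < c ->
  (mu [set s | c%:E < HL_maximal (bdry (g ^+ 2)) s] <=
   (3 / c * (4 * pi * nsq (fun k => g`_k)))%:E)%E.
Proof.
move=> c0; apply: (le_trans (maximal_inequality (bdry_loc _) c0)).
rewrite [leRHS]EFinM; apply: lee_wpmul2l; first by rewrite lee_fin divr_ge0// ltW.
cbv beta.
have pi0 := pi_gt0 R.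
under eq_integral do rewrite ?abse_EFin ger0_norm ?bdry_ge0//.
have cg : continuous (fun s => cmod g.[cis s] ^+ 2).
  by move=> s; apply: cvgR_X; exact: cmod_poly_cont.
pose F s := (cmod g.[cis s] ^+ 2)%:E.
have mF D : measurable_fun D F.
  apply: measurable_funTS; apply/measurable_EFinP; exact: continuous_measurable_fun.
have F0 s : (0 <= F s)%E by rewrite lee_fin sqr_ge0.
have per x : (\int[mu]_(s in `[x, (x + 2 * pi)%R]) F s =
    (2 * pi * nsq (fun k => g`_k))%:E)%E.
  rewrite -(poly_parseval x) /Rintegral fineK//.
  by apply: integrable_fin_num => //; exact: cont_integrable.
have -> : (\int[mu]_s (bdry (g ^+ 2) s)%:E = \int[mu]_(s in W) F s)%E.
  rewrite [RHS]integral_mkcond; apply: eq_integral => s _.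
  rewrite /bdry !patchE; case: ifP => // _.
  by rewrite /F horner_exp cmodX.
pose A : set R := `[(- pi)%R, (- pi + 2 * pi)%R]%classic.
pose B : set R := `](- pi + 2 * pi)%R, (- pi + 2 * pi + 2 * pi)%R]%classic.
have mA : measurable A by exact: measurable_itv.
have mB : measurable B by exact: measurable_itv.
have WAB : W `<=` A `|` B.
  move=> s /=; rewrite !in_itv/= => /andP[s1 s2].
  have E3 : - pi + 2 * pi + 2 * pi = 3 * pi :> R by ring.
  have [h|h] := leP s (- pi + 2 * pi); [left|right].
    by rewrite /A /= in_itv/= s1 h.
  by rewrite /B /= in_itv/= h E3 s2.
have dAB : [disjoint A & B].
  apply/disj_setPS => s []; rewrite /A /B /= !in_itv/= => /andP[_ h1] /andP[h2 _].
  by move: (lt_le_trans h2 h1); rewrite ltxx.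
apply: (@le_trans _ _ (\int[mu]_(s in A `|` B) F s)%E).
  apply: ge0_subset_integral => //; last exact: mF.
  exact: (measurableU _ _ mA mB).
rewrite (ge0_integral_setU mu mA mB (mF _) (fun x _ => F0 x) dAB).
rewrite /A /B integral_itv_obnd_cbnd; last exact: mF.
by rewrite !per -EFinD lee_fin le_eqVlt; apply/orP; left; apply/eqP; ring.
Qed.

End Maximal.

(** * The theorem of Fatou on non-tangential limits *)

Section Fatou.
Context {R : realType}.
Local Notation C := R[i].
Local Notation mu := (@lebesgue_measure R).
Implicit Types (x s t : R) (z : C) (g : {poly C}) (c : nat -> C).

Definition tpoly c N : {poly C} := \poly_(k < N) c k.

Lemma tpoly_coef c N k : (tpoly c N)`_k = cutoff c N k.
Proof. by rewrite coef_poly. Qed.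

Lemma psum_poly g z : psum (fun k => g`_k) z = g.[z].
Proof.
apply: csum_unique; apply/cvgC/cvgrPdist_lt => d d0.
exists (size g) => // n /= gn; rewrite /series/= horner_coef.
rewrite (big_cat_nat (leq0n (size g)) gn)/= big_mkord.
rewrite [X in 0 - cmod X]addrAC subrr !add0r sum_ge_eq0 ?cmod0 ?oppr0 ?normr0// => i gi.
by rewrite nth_default ?mul0r.
Qed.

Lemma psum_tpoly c N z : psum (cutoff c N) z = (tpoly c N).[z].
Proof.
rewrite -psum_poly; congr (psum _ z).
by apply/funext => k; rewrite tpoly_coef.
Qed.

Lemma psum_le c z : l2 c -> cmod z < 1 -> cmod (psum c z) <= nrm c / (1 - cmod z).
Proof. by move=> lc z1; apply: csum_geo_le => //; exact: l2_bounded. Qed.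

Lemma tpoly_dist c N z : l2 c -> cmod z < 1 ->
  cmod (psum c z - (tpoly c N).[z]) <= nrm (fun k => c k - cutoff c N k) / (1 - cmod z).
Proof.
move=> lc z1; have lt := @l2_cutoff _ c N.
have -> : psum c z - (tpoly c N).[z] = psum (fun k => c k - cutoff c N k) z.
  rewrite -psum_tpoly -mulN1r -psum_lin//; congr (psum _ z).
  by apply/funext => k; rewrite mulN1r.
by apply: psum_le => //; exact: l2B.
Qed.

Lemma horner_cont g : continuous (fun z => g.[z]).
Proof.
have -> : (fun z => g.[z]) = (fun z => \sum_(i < size g) g`_i * z ^+ i).
  by apply/funext => z; rewrite horner_coef.
move=> z; apply: (@cvgC_sum _ _ (nbhs z)) => i; apply: cvgMr.
exact: (@cvgC_X _ _ (nbhs z) _ id z i).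
Qed.

Lemma cauchy_geo (w : nat -> C) (K : R) n0 :
  (forall j, (n0 <= j)%N -> cmod (w j.+1 - w j) <= K * 2^-1 ^+ j) ->
  exists l, w @ \oo --> l /\
    forall j, (n0 <= j)%N -> cmod (l - w j) <= 2 * K * 2^-1 ^+ j.
Proof.
move=> H; pose u j k := w (j + k).+1 - w (j + k)%N.
have ser j n : series (u j) n = w (j + n)%N - w j.
  rewrite /series/= /u; elim: n => [|n IH]; first by rewrite big_geq// addn0 subrr.
  by rewrite big_nat_recr//= IH addnS addrC subrKA.
have bd j n : (n0 <= j)%N -> series (fun k => cmod (u j k)) n <= 2 * K * 2^-1 ^+ j.
  move=> nj.
  have K0 : 0 <= K * 2^-1 ^+ j by apply: le_trans (H j nj); exact: cmod_ge0.
  apply: (@le_trans _ _ (\sum_(0 <= k < n) K * 2^-1 ^+ j * 2^-1 ^+ k)).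
    rewrite /series/= ler_sum// => k _; apply: le_trans (H _ _) _.
      by rewrite (leq_trans nj)// leq_addr.
    by rewrite exprD mulrA.
  rewrite -mulr_sumr (_ : 2 * K * _ = K * 2^-1 ^+ j * 2); last by ring.
  apply: ler_wpM2l => //.
  exact: geo_half_le.
have cv j : (n0 <= j)%N -> w @ \oo --> w j + csum (u j).
  move=> nj; have su : summ (u j).
    apply: nondecreasing_is_cvgn; last by exists (2 * K * 2^-1 ^+ j) => _ [n _ <-]; exact: bd.
    by apply: nondecreasing_series => n *; exact: cmod_ge0.
  rewrite -(cvg_shiftn j)/=.
  have -> : (fun n => w (n + j)%N) = (fun n => w j + series (u j) n).
    by apply/funext => n; rewrite ser addrC subrK addnC.
  by apply: cvgD; [exact: cvg_cst|exact: csum_cvg].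
exists (w n0 + csum (u n0)); split; first exact: cv.
move=> j nj; rewrite (cvgC_unique _ (cv _ (leqnn n0)) (cv _ nj)) addrC addKr.
by apply: csum_le => n; exact: bd.
Qed.

Definition radial t n : C := (1 - n.+1%:R^-1)%:C * cis t.

Lemma radial_stolz (M : R) t n : 1 < M -> stolz M (cis t) (radial t n).
Proof.
move=> M1; have n0 : 0 < n.+1%:R^-1 :> R by rewrite invr_gt0.
have n1 : n.+1%:R^-1 <= 1 :> R by rewrite invf_le1// ler1n.
have E : cmod (radial t n) = 1 - n.+1%:R^-1.
  by rewrite /radial cmodM cmod_cis mulr1 cmod_real ger0_norm// subr_ge0.
split; first by rewrite /unit_disc /mkset E gtrBl.
rewrite E subKr.
have -> : cis t - radial t n = (n.+1%:R^-1)%:C * cis t.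
  by rewrite /radial rmorphB/= rmorph1 mulrBl mul1r subKr.
rewrite cmodM cmod_cis mulr1 cmod_real ger0_norm ?ltW//.
by rewrite ltr_pMl.
Qed.

Lemma radial_cvg t : radial t @ \oo --> cis t.
Proof.
rewrite -[X in _ --> X]mul1r; apply: cvgMl.
apply/cvgC_split; split; last exact: cvg_cst.
rewrite /= -[X in _ --> X]subr0; apply: cvgB; first exact: cvg_cst.
exact: cvg_harmonic.
Qed.

(** The radius ends in every non-tangential region, so limits along these regions
are limits along one sequence; this makes them unique. *)
Lemma radial_within (M : R) t : 1 < M ->
  radial t @ \oo --> within (stolz M (cis t)) (nbhs (cis t)).
Proof.
move=> M1 A /= wA; have := @radial_cvg t _ wA; rewrite /=.
by case=> n _ Hn; exists n => // k nk; apply: (Hn k nk); exact: radial_stolz.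
Qed.

Lemma nt_limit_radial (f : C -> C) t l : nontangential_limit f (cis t) l ->
  (fun n => f (radial t n)) @ \oo --> l.
Proof.
move=> H; have M1 : (1 : R) < 2 by lra.
exact: (cvg_comp _ _ (@radial_within 2 t M1) (H 2 M1)).
Qed.

Lemma boundary_valueE (f : C -> C) t l : nontangential_limit f (cis t) l ->
  boundary_value f t = l.
Proof.
move=> H; apply: xget_unique => // y /nt_limit_radial Hy.
exact: cvgC_unique _ Hy (nt_limit_radial H).
Qed.

Lemma maximal_bound (M : R) : 1 < M -> exists2 K : R, 0 <= K & forall g t z j,
  0 <= t <= 2 * pi -> stolz M (cis t) z ->
  (HL_maximal (bdry (g ^+ 2)) t <= (4^-1 ^+ j)%:E)%E -> cmod g.[z] <= K * 2^-1 ^+ j.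
Proof.
move=> M1; exists (Num.sqrt (4 * layer M / pi)); first exact: sqrtr_ge0.
move=> g t z j t01 zt HL; have pi0 := pi_gt0 R.
have h4 : 0 <= 4^-1 ^+ j :> R by rewrite exprn_ge0.
have := nontangential_maximal M1 t01 zt h4 HL.
rewrite horner_exp cmodX => h.
have L0 : 0 <= 4 * layer M / pi.
  by rewrite divr_ge0 ?(ltW pi0)// mulr_ge0// /layer mulr_ge0// sqr_ge0.
rewrite -ler_sqr ?nnegrE ?cmod_ge0 ?mulr_ge0 ?sqrtr_ge0 ?exprn_ge0//.
rewrite exprMn sqr_sqrtr// -exprM mulnC exprM.
have -> : 2^-1 ^+ 2 = 4^-1 :> R by rewrite exprVn; congr (_^-1); ring.
by rewrite mulrAC ler_pdivlMr// mulrC.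
Qed.

Lemma measurable_HL_level g (h : R) :
  measurable [set s | (h%:E < HL_maximal (bdry g) s)%E].
Proof.
rewrite -[X in measurable X]setTI; apply: emeasurable_fun_o_infty => //.
by apply: measurable_HL_maximal; exact: bdry_loc.
Qed.

(** Borel-Cantelli: the [j]-th exceptional set has measure at most
[48 pi 4^-j].  It does not depend on the aperture of the non-tangential
region. *)
Lemma maximal_exceptional (d : nat -> {poly C}) :
  (forall j, nsq (fun k => (d j)`_k) <= 4 * (4^-1 ^+ j) ^+ 2) ->
  exists B : set R, [/\ measurable B, mu B = 0%E & forall t, ~ B t ->
    exists n, forall j, (n <= j)%N -> (HL_maximal (bdry (d j ^+ 2)) t <= (4^-1 ^+ j)%:E)%E].
Proof.
move=> dj; have pi0 := pi_gt0 R.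
pose E j := [set s | ((4^-1 ^+ j : R)%:E < HL_maximal (bdry (d j ^+ 2)) s)%E].
have mE j : measurable (E j) by exact: measurable_HL_level.
exists (lim_sup_set E); split.
- by apply: bigcap_measurable => // n _; apply: bigcup_measurable => k _; exact: mE.
- apply: lim_sup_set_cvg0 => //.
  (* [48 pi 4^-n <= 96 pi / 2^(n+1)], a majorant whose series is summed by [epsilon_trick0] *)
  apply: (@le_lt_trans _ _ (\sum_(n <oo) ((96 * pi) / (2 ^ n.+1)%:R)%:E)%E); last first.
    apply: le_lt_trans (epsilon_trick0 _ _) (ltry _).
    by rewrite mulr_ge0// ltW.
  apply: lee_nneseries => [//|n _]; rewrite [E]lock -lock.
  have q0 : 0 < 4^-1 ^+ n :> R by rewrite exprn_gt0.
  apply: le_trans (maximal_weak (d n) q0) _; rewrite lee_fin.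
  apply: (@le_trans _ _ (3 / 4^-1 ^+ n * (4 * pi * (4 * (4^-1 ^+ n) ^+ 2)))).
    apply: ler_wpM2l; first by rewrite divr_ge0// ltW.
    by rewrite ler_wpM2l// mulr_ge0// ltW.
  have -> : 3 / 4^-1 ^+ n * (4 * pi * (4 * (4^-1 ^+ n) ^+ 2)) = 48 * pi * 4^-1 ^+ n :> R.
    by field; rewrite gt_eqF.
  have -> : 96 * pi / (2 ^ n.+1)%:R = 48 * pi * 2^-1 ^+ n :> R.
    rewrite natrX exprS exprVn; field.
    by rewrite expf_neq0.
  apply: ler_wpM2l; first by rewrite mulr_ge0// ltW.
  by rewrite lerXn2r ?nnegrE; lra.
- move=> t; rewrite /lim_sup_set => nt.
  have [n Hn] : exists n, ~ (\bigcup_(j >= n) E j) t.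
    by apply/existsNP => H; apply: nt => n _; exact: H.
  exists n => j nj; rewrite leNgt; apply/negP => h.
  by apply: Hn; exists j.
Qed.

Lemma approx_seq c : l2 c -> exists N : nat -> nat, forall j,
  nrm (fun k => c k - cutoff c (N j) k) < 4^-1 ^+ j.
Proof.
move=> lc.
have H j : exists n, nrm (fun k => c k - cutoff c n k) < 4^-1 ^+ j.
  by apply: cutoff_approx lc _; exact: exprn_gt0.
by have [N HN] := boolp.choice H; exists N.
Qed.

(** The partial sums [p j] are chosen so that the norm of [p j.+1 - p j] decreases
geometrically.  Off the exceptional set, [p j] converges uniformly on the
non-tangential regions at [e^{it}] and at [e^{it}] itself, and the two limits can
be exchanged. *)
Lemma fatou_theorem c (f : C -> C) : l2 c ->
  (forall z, unit_disc z -> f z = psum c z) ->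
  exists (N : nat -> nat) (B : set R), [/\
    forall j, nrm (fun k => c k - cutoff c (N j) k) < 4^-1 ^+ j,
    measurable B, mu B = 0%E & forall t, 0 <= t <= 2 * pi -> ~ B t ->
     ((tpoly c (N j)).[cis t] @[j --> \oo] --> boundary_value f t) /\
     nontangential_limit f (cis t) (boundary_value f t)].
Proof.
move=> lc fc; have [N HN] := approx_seq lc.
pose p j := tpoly c (N j); pose d j := p j.+1 - p j.
have lt j := @l2_cutoff _ c j.
have dj j : nsq (fun k => (d j)`_k) <= 4 * (4^-1 ^+ j) ^+ 2.
  have -> : (fun k => (d j)`_k) = (fun k => cutoff c (N j.+1) k - cutoff c (N j) k).
    by apply/funext => k; rewrite coefB !tpoly_coef.
  rewrite -sqr_nrm (_ : 4 * (4^-1 ^+ j) ^+ 2 = (4^-1 ^+ j + 4^-1 ^+ j) ^+ 2); last by ring.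
  have q0 : 0 < 4^-1 ^+ j :> R by rewrite exprn_gt0.
  rewrite ler_sqr ?nnegrE ?nrm_ge0 ?addr_ge0 ?(ltW q0)//.
  apply: le_trans (nrm_subC (lt _) lc (lt _)) _; apply: lerD; last exact: ltW.
  rewrite nrmBC; apply: le_trans (ltW (HN _)) _.
  by rewrite exprS ler_piMl// ?ltW//; lra.
have [B [mB B0 HB]] := maximal_exceptional dj.
have step z j : (p j.+1).[z] - (p j).[z] = (d j).[z] by rewrite /d hornerD hornerN.
have pz z : cmod z < 1 -> (fun j => (p j).[z]) @ \oo --> psum c z.
  move=> z1; apply/cvgC.
  have d0 : 0 < 1 - cmod z by rewrite subr_gt0.
  apply: (@squeeze_cvgr _ _ _ _ (fun=> 0) (fun j => (1 - cmod z)^-1 * 4^-1 ^+ j)).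
  - apply: nearW => j; rewrite cmod_ge0 cmodBC/=.
    apply: le_trans (tpoly_dist _ lc z1) _.
    by rewrite mulrC ler_wpM2l ?invr_ge0 ?(ltW d0)// ltW.
  - exact: cvg_cst.
  - rewrite -[X in _ --> X](mulr0 (1 - cmod z)^-1); apply: cvgMr.
    by apply: cvg_expr; rewrite ger0_norm; lra.
exists N, B; split=> // t t01 nBt.
have [n0 Hn0] := HB t nBt.
(* The point [cis t] itself is reached along the radius, where any aperture
   greater than 1 will do. *)
have M2 : (1 : R) < 2 by lra.
have [K2 K20 HK2] := maximal_bound M2.
have [l [pl lp]] : exists l, (fun j => (p j).[cis t]) @ \oo --> l /\
    forall j, (n0 <= j)%N -> cmod (l - (p j).[cis t]) <= 2 * K2 * 2^-1 ^+ j.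
  apply: cauchy_geo => j nj; rewrite step.
  have cd : (fun n => cmod (d j).[radial t n]) @ \oo --> cmod (d j).[cis t].
    apply: cvg_cmod; apply: (@continuous_cvg _ _ _ _ _ _ (fun z => (d j).[z])).
      exact: horner_cont.
    exact: radial_cvg.
  rewrite -(cvg_lim _ cd)//; apply: limr_le; first exact: cvgP cd.
  by apply: nearW => n; apply: HK2 t01 (radial_stolz _ _ M2) (Hn0 _ nj).
suff ntl : nontangential_limit f (cis t) l by rewrite (boundary_valueE ntl).
move=> M M1; have [K K0 HK] := maximal_bound M1.
apply/cvgC/cvgrPdist_lt => eps eps0.
have e3 : 0 < eps / 3 by rewrite divr_gt0.
have [j [nj hj]] : exists j, (n0 <= j)%N /\ (2 * K + 2 * K2) * 2^-1 ^+ j < eps / 3.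
  have g0 : (fun j => (2 * K + 2 * K2) * 2^-1 ^+ j) @ \oo --> (0 : R).
    rewrite -[X in _ --> X](mulr0 (2 * K + 2 * K2)); apply: cvgMr.
    by apply: cvg_expr; rewrite ger0_norm; lra.
  have /cvgrPdist_lt/(_ _ e3)[n1 _ Hn1] := g0.
  exists (maxn n0 n1); split; first by rewrite leq_maxl.
  have := Hn1 (maxn n0 n1) (leq_maxr _ _); rewrite sub0r normrN; apply: le_lt_trans.
  exact: ler_norm.
have q0 : 0 <= 2^-1 ^+ j :> R by rewrite exprn_ge0//; lra.
have pc : \forall z \near within (stolz M (cis t)) (nbhs (cis t)),
    cmod ((p j).[z] - (p j).[cis t]) < eps / 3.
  apply: cvg_within; have /cvgC /cvgrPdist_lt/(_ _ e3) := @horner_cont (p j) (cis t).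
  by apply: filterS => z; rewrite sub0r normrN ger0_norm ?cmod_ge0.
near=> z.
have zs : stolz M (cis t) z by near: z; exact: withinT.
have z1 : cmod z < 1 by case: zs.
have h2 : cmod ((p j).[z] - (p j).[cis t]) < eps / 3 by near: z.
have h1 : cmod (f z - (p j).[z]) <= 2 * K * 2^-1 ^+ j.
  have [l' [pl' lp']] : exists l', (fun j => (p j).[z]) @ \oo --> l' /\
      forall j, (n0 <= j)%N -> cmod (l' - (p j).[z]) <= 2 * K * 2^-1 ^+ j.
    by apply: cauchy_geo => i ni; rewrite step; apply: HK t01 zs (Hn0 _ ni).
  by rewrite fc// (cvgC_unique _ (pz z z1) pl'); exact: lp'.
have h3 := lp j nj.
rewrite sub0r normrN ger0_norm ?cmod_ge0//.
have -> : f z - l = (f z - (p j).[z]) + (((p j).[z] - (p j).[cis t]) - (l - (p j).[cis t])).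
  by ring.
apply: le_lt_trans (cmodD _ _) _.
apply: le_lt_trans (lerD h1 (cmodD _ _)) _; rewrite cmodN.
have hh : 2 * K * 2^-1 ^+ j + 2 * K2 * 2^-1 ^+ j < eps / 3 by rewrite -mulrDl.
move: h2 h3 hh; set x1 := cmod _; set x2 := cmod _.
move: (2 * K * _) (2 * K2 * _) x1 x2 => y1 y2 x1 x2 h2 h3 hh; lra.
Unshelve. all: by end_near. Qed.

End Fatou.

(** * Boundary values in the space of square-integrable functions *)

Section NullSets.
Import HBNNSimple.
Context d (T : measurableType d) (R : realType) (mu : {measure set T -> \bar R}).
Local Open Scope ereal_scope.

(** For arbitrary [f] and [g], because boundary values are known to be measurable
only off a null set.  The integral of a nonnegative function is a supremum over
simple functions, and each of these may be cut off on [B]. *)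
Lemma ge0_integral_null_le (B : set T) (f g : T -> \bar R) :
  measurable B -> mu B = 0 -> (forall x, 0 <= f x) -> (forall x, 0 <= g x) ->
  (forall x, ~ B x -> f x <= g x) -> \int[mu]_x f x <= \int[mu]_x g x.
Proof.
move=> mB B0 f0 g0 fg; rewrite (ge0_integralTE mu f0) (ge0_integralTE mu g0).
apply: ge_ereal_sup => _ [h hf <-].
have mC : measurable (~` B) by exact: measurableC.
apply: ereal_sup_ubound; exists (proj_nnsfun h mC).
  rewrite /mkset => x; rewrite -mrestrict patchE.
  have [xB|xB] := pselect (B x); first by rewrite memNset//; exact: g0.
  by rewrite mem_set//; exact: le_trans (hf x) (fg x xB).
have mh : measurable_fun setT (fun x => (h x)%:E) by exact/measurable_EFinP.
have h0 x : [set: T] x -> 0 <= (h x)%:E by rewrite lee_fin.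
rewrite -[RHS]integralT_nnsfun (ge0_negligible_integral mB measurableT mh h0 B0).
rewrite integral_nnsfun; last exact: measurableD.
by rewrite -mrestrict setTD.
Qed.

Lemma integral_null (D B : set T) (f : T -> \bar R) :
  measurable B -> mu B = 0 -> \int[mu]_(x in D) f x = \int[mu]_(x in D `\` B) f x.
Proof.
move=> mB B0.
have H (g : T -> \bar R) : (forall x, 0 <= g x) ->
    \int[mu]_(x in D) g x = \int[mu]_(x in D `\` B) g x.
  move=> g0; rewrite integral_mkcond [RHS]integral_mkcond.
  have p0 (E : set T) x : 0 <= (g \_ E) x by rewrite patchE; case: ifP.
  apply/eqP; rewrite eq_le; apply/andP; split;
    apply: (ge0_integral_null_le mB B0) => // x xB; rewrite !patchE.
    have [xD|xD] := pselect (D x); last by rewrite memNset//; case: ifP.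
    by rewrite !mem_set.
  have [xD|xD] := pselect (D x); first by rewrite [x \in D]mem_set//; case: ifP.
  by rewrite [x \in _]memNset => [|[]//]; case: ifP => // _; exact: g0.
rewrite integralE [RHS]integralE; congr (_ - _); apply: H => x.
  exact: funepos_ge0.
exact: funeneg_ge0.
Qed.

Lemma Rintegral_null (D B : set T) (f : T -> R) :
  measurable B -> mu B = 0 ->
  (\int[mu]_(x in D) f x = \int[mu]_(x in D `\` B) f x)%R.
Proof. by move=> mB B0; rewrite /Rintegral (integral_null _ _ mB B0). Qed.

Lemma limn_einf_le (u : (\bar R)^nat) b : (forall n, u n <= b) -> limn_einf u <= b.
Proof.
move=> ub; rewrite limn_einf_lim; apply: lime_le; first exact: is_cvg_einfs.
apply: nearW => n; apply: le_trans (ub n).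
by apply: ereal_inf_lbound; exists n => /=.
Qed.

End NullSets.

Section Parseval.
Context {R : realType}.
Local Notation C := R[i].
Local Notation mu := (@lebesgue_measure R).
Local Notation I0 := (`[0, 2 * pi]%classic : set R).
Implicit Types (x s t : R) (z : C) (g : {poly C}) (c : nat -> C).

Lemma leb_null (D B : set R) (f : R -> \bar R) : measurable B -> mu B = 0%E ->
  (\int[mu]_(x in D) f x = \int[mu]_(x in D `\` B) f x)%E.
Proof. by move=> mB B0; exact: (@integral_null _ _ R mu). Qed.

(** Take [d = h^2] and let [h] tend to zero. *)
Lemma approx_le (x y : R) : 0 <= y ->
  (forall h d, 0 < h -> 0 < d -> x <= (1 + h) * y + (1 + h^-1) * d + d) -> x <= y.
Proof.
move=> y0 H; apply/ler_addgt0Pr => a a0.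
(* [h <= 1] and [h (y + 3) <= a], which absorbs the terms [h y], [h^2 + h] and [h^2]. *)
pose h := a / (y + 3 + a); have D0 : 0 < y + 3 + a by lra.
have h0 : 0 < h by rewrite divr_gt0.
have h1 : h <= 1 by rewrite ler_pdivrMr//; lra.
have ha : h * (y + 3) <= a.
  by rewrite mulrAC ler_pdivrMr// ler_pM2l//; lra.
have h20 : 0 < h ^+ 2 by rewrite exprn_gt0.
apply: le_trans (H h (h ^+ 2) h0 h20) _.
have -> : (1 + h^-1) * h ^+ 2 = h ^+ 2 + h by field; rewrite gt_eqF.
have : h ^+ 2 <= h by rewrite expr2 ler_piMl// ltW.
by lra.
Qed.

Definition trig c N t := (tpoly c N).[cis t].

Lemma int_I0_poly g :
  (\int[mu]_(t in I0) (cmod g.[cis t] ^+ 2)%:E = (2 * pi * nsq (fun k => g`_k))%:E)%E.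
Proof.
have := poly_parseval 0 g; rewrite add0r => <-.
rewrite /Rintegral fineK//; apply: integrable_fin_num => //.
by apply: cont_integrable => t; apply: cvgR_X; exact: cmod_poly_cont.
Qed.

Lemma int_sub_poly g (B : set R) : measurable B -> mu B = 0%E ->
  (\int[mu]_(t in I0 `\` B) (cmod g.[cis t] ^+ 2)%:E = (2 * pi * nsq (fun k => g`_k))%:E)%E.
Proof. by move=> mB B0; rewrite -(leb_null _ _ mB B0) int_I0_poly. Qed.

Lemma nsq_cutoff_le c N : l2 c -> nsq (cutoff c N) <= nsq c.
Proof.
move=> lc; rewrite (nsq_fin (@cutoff0 _ c N)).2; apply: le_trans (nsq_ub N lc).
rewrite /series/= big_nat_cond [leRHS]big_nat_cond; apply: ler_sum => k.
by rewrite andbT => /andP[_ kN]; rewrite /cutoff kN.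
Qed.

Lemma nsq_dist c d : l2 c -> l2 d -> nrm d <= nrm c ->
  nsq c - nsq d <= 2 * nrm c * nrm (fun k => c k - d k).
Proof.
move=> lc ld dc; rewrite -!sqr_nrm subr_sqr mulrC.
apply: ler_pM; [exact: addr_ge0 (nrm_ge0 _) (nrm_ge0 _)|by rewrite subr_ge0| |exact: nrm_dist].
by rewrite mulrDl mul1r lerD2l.
Qed.

Record bdry_data (f : C -> C) c (B : set R) : Prop := BdryData {
  bd_meas : measurable B;
  bd_null : mu B = 0%E;
  bd_Re : measurable_fun (I0 `\` B) (fun t => complex.Re (boundary_value f t));
  bd_Im : measurable_fun (I0 `\` B) (fun t => complex.Im (boundary_value f t));
  bd_lim : forall t, (I0 `\` B) t -> nontangential_limit f (cis t) (boundary_value f t);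
  bd_int : (\int[mu]_(t in I0) (cmod (boundary_value f t) ^+ 2)%:E =
     (2 * pi * nsq c)%:E)%E }.

Lemma measurable_sqr_cmod (D : set R) (h : R -> C) :
  measurable_fun D (fun t => complex.Re (h t)) ->
  measurable_fun D (fun t => complex.Im (h t)) ->
  measurable_fun D (fun t => (cmod (h t) ^+ 2)%:E).
Proof.
move=> mr mi; apply/measurable_EFinP.
under eq_fun do rewrite sqr_cmod.
by apply: measurable_funD; apply: measurable_funX.
Qed.

Lemma int_sqr_le (D : set R) (h k : R -> C) (a : R) : measurable D -> 0 < a ->
  measurable_fun D (fun t => complex.Re (h t)) ->
  measurable_fun D (fun t => complex.Im (h t)) ->
  measurable_fun D (fun t => complex.Re (k t)) ->
  measurable_fun D (fun t => complex.Im (k t)) ->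
  (\int[mu]_(t in D) (cmod (h t + k t) ^+ 2)%:E <=
   (1 + a)%:E * \int[mu]_(t in D) (cmod (h t) ^+ 2)%:E +
   (1 + a^-1)%:E * \int[mu]_(t in D) (cmod (k t) ^+ 2)%:E)%E.
Proof.
move=> mD a0 hr hi kr ki.
have mh := measurable_sqr_cmod hr hi; have mk := measurable_sqr_cmod kr ki.
have sq0 (u : R -> C) t : D t -> (0 <= (cmod (u t) ^+ 2)%:E)%E by rewrite lee_fin sqr_ge0.
have a1 : 0 <= 1 + a by lra.
have a2 : 0 <= 1 + a^-1 by rewrite addr_ge0// invr_ge0 ltW.
rewrite -(ge0_integralZl_EFin mu mD (sq0 h) mh a1).
rewrite -(ge0_integralZl_EFin mu mD (sq0 k) mk a2).
rewrite -ge0_integralD//.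
- apply: ge0_le_integral => //.
  + by move=> t _; rewrite lee_fin sqr_ge0.
  + apply: measurable_sqr_cmod.
      by under eq_fun do rewrite raddfD/=; exact: measurable_funD.
    by under eq_fun do rewrite raddfD/=; exact: measurable_funD.
  + by apply: emeasurable_funD; exact: measurable_funeM.
  + by move=> t _; rewrite -!EFinM -EFinD lee_fin; exact: sqr_cmodD.
- by move=> t _; rewrite mule_ge0 ?lee_fin ?sqr_ge0.
- exact: measurable_funeM.
- by move=> t _; rewrite mule_ge0 ?lee_fin ?sqr_ge0.
- exact: measurable_funeM.
Qed.

(** The boundary values are the pointwise limits of a subsequence of partial sums.
The lemma of Fatou shows that they are also its limits in [L^2], and the norms
of the partial sums are known exactly. *)
Lemma bdry_exists c (f : C -> C) : l2 c ->
  (forall z, unit_disc z -> f z = psum c z) -> exists B, bdry_data f c B.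
Proof.
move=> lc fc; have [N [B [HN mB B0 HB]]] := fatou_theorem lc fc.
have pi0 := pi_gt0 R.
pose D := I0 `\` B.
have mD : measurable D by apply: measurableD.
have DI t : D t -> 0 <= t <= 2 * pi by move=> [] /=; rewrite in_itv/=.
have Dlim t : D t -> (fun j => trig c (N j) t) @ \oo --> boundary_value f t.
  by move=> Dt; have [] := HB t (DI t Dt) Dt.2.
have Dnt t : D t -> nontangential_limit f (cis t) (boundary_value f t).
  by move=> Dt; have [] := HB t (DI t Dt) Dt.2.
have cq j : continuous (trig c (N j)) by exact: poly_cis_cont.
have mqr j : measurable_fun D (fun t => complex.Re (trig c (N j) t)).
  by apply: measurable_funTS; apply: continuous_measurable_fun; exact: contRe.
have mqi j : measurable_fun D (fun t => complex.Im (trig c (N j) t)).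
  by apply: measurable_funTS; apply: continuous_measurable_fun; exact: contIm.
have mFr : measurable_fun D (fun t => complex.Re (boundary_value f t)).
  apply: (measurable_fun_cvg mqr) => t Dt.
  by have /cvgC_split[] := Dlim t Dt.
have mFi : measurable_fun D (fun t => complex.Im (boundary_value f t)).
  apply: (measurable_fun_cvg mqi) => t Dt.
  by have /cvgC_split[] := Dlim t Dt.
exists B; split => //.
pose F := boundary_value f.
have q4 j : 0 < 4^-1 ^+ j :> R by rewrite exprn_gt0.
(* The lemma of Fatou, applied for fixed [j] to the differences
   [p (j + i) - p j] as [i] grows. *)
have X j : (\int[mu]_(t in D) (cmod (F t - trig c (N j) t) ^+ 2)%:E <=
   (2 * pi * (2 * 4^-1 ^+ j) ^+ 2)%:E)%E.
  pose dp (i : nat) : {poly C} := tpoly c (N (j + i)%N) - tpoly c (N j).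
  have ge (i : nat) t : (dp i).[cis t] = trig c (N (j + i)%N) t - trig c (N j) t by rewrite hornerD hornerN.
  have lim t : D t -> (fun i => (cmod (dp i).[cis t] ^+ 2)%:E) @ \oo --> (cmod (F t - trig c (N j) t) ^+ 2)%:E.
    move=> Dt; apply: cvg_EFin; first exact: nearW.
    have H : (fun i => trig c (N (j + i)%N) t) @ \oo --> F t.
      have -> : (fun i => trig c (N (j + i)%N) t) = (fun i => trig c (N (i + j)%N) t).
        by apply/funext => i; rewrite addnC.
      by have := Dlim t Dt; rewrite -(cvg_shiftn j).
    have H2 : (fun i => cmod (dp i).[cis t]) @ \oo --> cmod (F t - trig c (N j) t).
      under eq_fun do rewrite ge.
      by apply: cvg_cmod; apply: cvgB; [exact: H|exact: cvg_cst].
    have H3 : (fun i => cmod (dp i).[cis t] ^+ 2) @ \oo --> cmod (F t - trig c (N j) t) ^+ 2.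
      by apply: cvgR_X; exact: H2.
    exact: H3.
  have -> : (\int[mu]_(t in D) (cmod (F t - trig c (N j) t) ^+ 2)%:E =
     \int[mu]_(t in D) limn_einf (fun i => (cmod (dp i).[cis t] ^+ 2)%:E))%E.
    by apply: eq_integral => t /set_mem Dt; rewrite (cvg_limn_einf_sup (lim t Dt)).1.
  apply: le_trans (fatou mu mD _ _) _.
  - move=> i; apply/measurable_EFinP; apply: measurable_funTS.
    apply: continuous_measurable_fun => t; apply: cvgR_X; exact: cmod_poly_cont.
  - by move=> i t _; rewrite lee_fin sqr_ge0.
  apply: limn_einf_le => i; rewrite int_sub_poly// lee_fin.
  rewrite ler_wpM2l ?mulr_ge0 ?(ltW pi0)// -sqr_nrm.
  have -> : (fun k => (dp i)`_k) = (fun k => cutoff c (N (j + i)%N) k - cutoff c (N j) k).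
    by apply/funext => k; rewrite coefB !tpoly_coef.
  have lt n := @l2_cutoff _ c n.
  rewrite ler_sqr ?nnegrE ?nrm_ge0 ?mulr_ge0 ?(ltW (q4 j))//.
  apply: le_trans (nrm_subC (lt _) lc (lt _)) _; rewrite mulrDl mul1r; apply: lerD; last exact: ltW.
  rewrite nrmBC; apply: le_trans (ltW (HN _)) _.
  rewrite exprD ler_piMr ?(ltW (q4 j))// exprn_ile1//; lra.
set V := (\int[mu]_(t in I0) _)%E.
have VD : V = (\int[mu]_(t in D) (cmod (F t) ^+ 2)%:E)%E by rewrite /V (leb_null _ _ mB B0).
set S := 2 * pi * nsq c.
have S0 : 0 <= S by rewrite mulr_ge0 ?nsq_ge0// mulr_ge0// ltW.
have V0 : (0 <= V)%E by apply: integral_ge0 => t _; rewrite lee_fin sqr_ge0.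
have small a : 0 < a -> exists j, (2 * pi * (2 * 4^-1 ^+ j) ^+ 2) <= a /\
    2 * pi * (2 * nrm c * 4^-1 ^+ j) <= a.
  move=> a0; pose K := 8 * pi + 4 * pi * nrm c.
  have g0 : (fun j => K * 4^-1 ^+ j) @ \oo --> (0 : R).
    rewrite -[X in _ --> X](mulr0 K); apply: cvgMr.
    by apply: cvg_expr; rewrite ger0_norm; lra.
  have /cvgrPdist_le/(_ _ a0)[j _ /(_ j (leqnn j))] := g0.
  rewrite sub0r normrN => h; exists j.
  have {}h : K * 4^-1 ^+ j <= a by apply: le_trans h; exact: ler_norm.
  have qn : 4^-1 ^+ j <= 1 :> R by rewrite exprn_ile1//; lra.
  have k0 : 0 <= 4 * pi * nrm c * 4^-1 ^+ j.
    by apply: mulr_ge0 _ (ltW (q4 j)); apply: mulr_ge0 _ (nrm_ge0 _); apply: mulr_ge0 _ (ltW pi0).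
  have k1 : (0 : R) <= 8 * pi * 4^-1 ^+ j.
    by apply: mulr_ge0 _ (ltW (q4 j)); apply: mulr_ge0 _ (ltW pi0).
  have hK : 8 * pi * 4^-1 ^+ j + 4 * pi * nrm c * 4^-1 ^+ j <= a by rewrite -mulrDl.
  split.
    have -> : 2 * pi * (2 * 4^-1 ^+ j) ^+ 2 = 8 * pi * 4^-1 ^+ j * 4^-1 ^+ j :> R by ring.
    by apply: le_trans (ler_piMr k1 qn) _; lra.
  have -> : 2 * pi * (2 * nrm c * 4^-1 ^+ j) = 4 * pi * nrm c * 4^-1 ^+ j :> R by ring.
  by lra.
have mDr j : measurable_fun D (fun t => complex.Re (F t - trig c (N j) t)).
  by under eq_fun do rewrite raddfB/=; exact: measurable_funB.
have mDi j : measurable_fun D (fun t => complex.Im (F t - trig c (N j) t)).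
  by under eq_fun do rewrite raddfB/=; exact: measurable_funB.
have intq j : (\int[mu]_(t in D) (cmod (trig c (N j) t) ^+ 2)%:E =
   (2 * pi * nsq (cutoff c (N j)))%:E)%E.
  rewrite int_sub_poly//; congr ((2 * pi * nsq _)%:E).
  by apply/funext => k; rewrite tpoly_coef.
have up a b j : 0 < a -> 2 * pi * (2 * 4^-1 ^+ j) ^+ 2 <= b ->
    (V <= ((1 + a) * S + (1 + a^-1) * b)%:E)%E.
  move=> a0 jb; rewrite VD.
  have -> : (fun t => (cmod (F t) ^+ 2)%:E) =
     (fun t => (cmod (trig c (N j) t + (F t - trig c (N j) t)) ^+ 2)%:E).
    by apply/funext => t; rewrite addrC subrK.
  apply: le_trans (int_sqr_le mD a0 (mqr j) (mqi j) (mDr j) (mDi j)) _.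
  rewrite [leRHS]EFinD; apply: leeD.
    rewrite intq -EFinM lee_fin; apply: ler_wpM2l; first by lra.
    by apply: ler_wpM2l; [rewrite mulr_ge0// ltW|exact: nsq_cutoff_le].
  rewrite [leRHS]EFinM; apply: lee_wpmul2l.
    by rewrite lee_fin addr_ge0// invr_ge0 ltW.
  by apply: le_trans (X j) _; rewrite lee_fin.
have [j1 [hj1 _]] := small 1 ltr01.
have Vfin : V \is a fin_num.
  rewrite ge0_fin_numE//; apply: le_lt_trans (up 1 1 j1 ltr01 hj1) _; exact: ltry.
pose v := fine V; have Vv : V = v%:E by rewrite /v fineK.
have v0 : 0 <= v by rewrite -lee_fin -Vv.
rewrite Vv; congr (_%:E); apply/eqP; rewrite eq_le; apply/andP; split.
  apply: approx_le => // a b a0 b0.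
  have [j [hj _]] := small b b0.
  have := up a b j a0 hj; rewrite Vv lee_fin => h; apply: le_trans h _.
  by rewrite lerDl ltW.
apply: approx_le => // a b a0 b0.
have [j [hj hj2]] := small b b0.
have lt := @l2_cutoff _ c (N j).
have h1 : S - 2 * pi * nsq (cutoff c (N j)) <= b.
  rewrite /S -mulrBr; apply: le_trans hj2; apply: ler_wpM2l; first by rewrite mulr_ge0// ltW.
  apply: le_trans (nsq_dist lc lt _) _.
    by rewrite ler_wsqrtr// nsq_cutoff_le.
  by apply: ler_wpM2l; [rewrite mulr_ge0 ?nrm_ge0|exact: ltW].
have h2 : 2 * pi * nsq (cutoff c (N j)) <= (1 + a) * v + (1 + a^-1) * b.
  rewrite -lee_fin -intq.
  have mnr : measurable_fun D (fun t => complex.Re (- (F t - trig c (N j) t))).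
    by under eq_fun do rewrite raddfN/=; exact: measurable_funN.
  have mni : measurable_fun D (fun t => complex.Im (- (F t - trig c (N j) t))).
    by under eq_fun do rewrite raddfN/=; exact: measurable_funN.
  have -> : (fun t => (cmod (trig c (N j) t) ^+ 2)%:E) =
     (fun t => (cmod (F t + - (F t - trig c (N j) t)) ^+ 2)%:E).
    by apply/funext => t; rewrite opprB addrC subrK.
  apply: le_trans (int_sqr_le mD a0 mFr mFi mnr mni) _.
  rewrite [leRHS]EFinD; apply: leeD; first by rewrite -VD Vv EFinM.
  rewrite [leRHS]EFinM; apply: lee_wpmul2l.
    by rewrite lee_fin addr_ge0// invr_ge0 ltW.
  under eq_integral do rewrite cmodN.
  by apply: le_trans (X j) _; rewrite lee_fin.
move: h1 h2; set y := (1 + a) * v + _; set x := 2 * pi * _ => h1 h2.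
by rewrite -lerBlDr; apply: le_trans h2; rewrite lerBlDr addrC -lerBlDr.
Qed.

End Parseval.

(** * Inner products on coefficients *)

Section Polarisation.
Context {R : realType}.
Local Notation C := R[i].
Local Notation mu := (@lebesgue_measure R).
Local Notation I0 := (`[0, 2 * pi]%classic : set R).
Implicit Types (a z w : C) (c d : nat -> C) (f g : C -> C).

Definition im1 : C := Complex 0 1.

(** The polarisation formula.  It reduces every identity between inner products
needed here to an identity between norms. *)
Definition l2dot c d : C :=
  Complex ((nsq (fun k => c k + 1 * d k) - nsq (fun k => c k + -1 * d k)) / 4)
          ((nsq (fun k => c k + im1 * d k) - nsq (fun k => c k + - im1 * d k)) / 4).

Lemma polar (x y : C) : x * conjc y =
  Complex ((cmod (x + 1 * y) ^+ 2 - cmod (x + -1 * y) ^+ 2) / 4)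
          ((cmod (x + im1 * y) ^+ 2 - cmod (x + - im1 * y) ^+ 2) / 4).
Proof.
rewrite !sqr_cmod mulN1r mul1r /im1; case: x y => [x1 x2] [y1 y2]; simpc.
by congr Complex => /=; field.
Qed.

Lemma nt_limit_lin f g w t l l' :
  nontangential_limit f (cis t) l -> nontangential_limit g (cis t) l' ->
  nontangential_limit (fun z => f z + w * g z) (cis t) (l + w * l').
Proof.
move=> fl gl M M1; apply: cvgD; first exact: fl.
by apply: cvgMr; exact: gl.
Qed.

(** Off a null set the boundary value of [f + w g] is [F + w G], so the integral
of [F conj G] is obtained by polarisation from the norms given by
[bdry_exists] for [w = 1, -1, i, -i]. *)
Lemma hip_l2dot c d f g : l2 c -> l2 d ->
  (forall z, unit_disc z -> f z = psum c z) ->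
  (forall z, unit_disc z -> g z = psum d z) -> hip f g = l2dot c d.
Proof.
move=> lc ld fc gd; have pi0 := pi_gt0 R.
have [Bf bf] := bdry_exists lc fc; have [Bg bg] := bdry_exists ld gd.
have comb w : exists B, bdry_data (fun z => f z + w * g z) (fun k => c k + w * d k) B.
  apply: bdry_exists; first by apply: l2D => //; exact: l2Z.
  by move=> z z1; rewrite psum_lin// fc// gd.
pose D := I0 `\` (Bf `|` Bg).
have mU : measurable (Bf `|` Bg) by apply: measurableU; [exact: bd_meas bf|exact: bd_meas bg].
have U0 : mu (Bf `|` Bg) = 0%E.
  rewrite (@measureU0 _ _ _ mu _ _ (bd_meas bf) (bd_meas bg) (bd_null bg)); exact: bd_null bf.
have mD : measurable D by apply: measurableD.
have Df t : D t -> (I0 `\` Bf) t by move=> [h1 h2]; split=> // h; apply: h2; left.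
have Dg t : D t -> (I0 `\` Bg) t by move=> [h1 h2]; split=> // h; apply: h2; right.
pose F := boundary_value f; pose G := boundary_value g.
have mFr : measurable_fun D (fun t => complex.Re (F t)).
  by apply: measurable_funS (bd_Re bf) => //; apply: measurableD => //; exact: bd_meas bf.
have mFi : measurable_fun D (fun t => complex.Im (F t)).
  by apply: measurable_funS (bd_Im bf) => //; apply: measurableD => //; exact: bd_meas bf.
have mGr : measurable_fun D (fun t => complex.Re (G t)).
  by apply: measurable_funS (bd_Re bg) => //; apply: measurableD => //; exact: bd_meas bg.
have mGi : measurable_fun D (fun t => complex.Im (G t)).
  by apply: measurable_funS (bd_Im bg) => //; apply: measurableD => //; exact: bd_meas bg.
pose Q w t : R := cmod (F t + w * G t) ^+ 2.
have mQ w : measurable_fun D (fun t => (Q w t)%:E).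
  apply: measurable_sqr_cmod.
    have -> : (fun t => complex.Re (F t + w * G t)) = (fun t => complex.Re (F t) +
        (complex.Re w * complex.Re (G t) - complex.Im w * complex.Im (G t))).
      by apply/funext => t; case: (F t) (G t) w => [? ?] [? ?] [? ?].
    by apply: measurable_funD => //; apply: measurable_funB; exact: measurable_funM.
  have -> : (fun t => complex.Im (F t + w * G t)) = (fun t => complex.Im (F t) +
      (complex.Re w * complex.Im (G t) + complex.Im w * complex.Re (G t))).
    by apply/funext => t; case: (F t) (G t) w => [? ?] [? ?] [? ?].
  by apply: measurable_funD => //; apply: measurable_funD; exact: measurable_funM.
have iQ w : (\int[mu]_(t in D) (Q w t)%:E = (2 * pi * nsq (fun k => c k + w * d k))%:E)%E.
  have [B bw] := comb w.
  rewrite -(bd_int bw) [RHS](leb_null _ _ mU U0); apply: eq_integral => t /set_mem Dt.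
  congr ((cmod _ ^+ 2)%:E); apply/esym/boundary_valueE.
  by apply: nt_limit_lin; [exact: (bd_lim bf (Df t Dt))|exact: (bd_lim bg (Dg t Dt))].
have Qi w : mu.-integrable D (EFin \o Q w).
  apply/integrableP; split; first exact: mQ.
  under eq_integral do rewrite /= ger0_norm ?sqr_ge0//.
  by rewrite iQ ltry.
have RQ w : \int[mu]_(t in D) Q w t = 2 * pi * nsq (fun k => c k + w * d k).
  by rewrite /Rintegral iQ.
have diff (h : R -> R) w w' : (forall t, h t = 4^-1 * (Q w t - Q w' t)) ->
    \int[mu]_(t in I0) h t =
    4^-1 * (2 * pi * nsq (fun k => c k + w * d k) - 2 * pi * nsq (fun k => c k + w' * d k)).
  move=> hE; rewrite (@Rintegral_null _ _ R mu _ _ _ mU U0) -/D.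
  under eq_Rintegral do rewrite hE.
  rewrite RintegralZl//; last first.
    have -> : EFin \o (fun t => Q w t - Q w' t) = ((EFin \o Q w) \- (EFin \o Q w'))%E by [].
    exact: integrableB.
  by rewrite RintegralB// !RQ.
rewrite /hip (diff _ 1 (-1)); last first.
  by move=> t; rewrite -/F -/G polar /Q/= mulrC.
rewrite (diff _ im1 (- im1)); last first.
  by move=> t; rewrite -/F -/G polar /Q/= mulrC.
have pn : (pi : R) != 0 by rewrite gt_eqF.
rewrite /l2dot; simpc; move: (pi : R) pn => p pn.
by congr Complex; field.
Qed.

(** Polarised form of [reduce_nsq].  It contains both the reproducing property of
the kernel ([reduce a (skern a) = 0]) and the fact that [reduce a] is the adjoint
of multiplication by the Blaschke factor ([psum (bmul a d) a = 0]). *)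
Lemma l2dot_reduce c d a : l2 c -> l2 d -> cmod a < 1 ->
  l2dot c d = l2dot (reduce a c) (reduce a d) + (1 - cmod a ^+ 2)%:C * (psum c a * conjc (psum d a)).
Proof.
move=> lc ld a1; have a1' := ltW a1.
have H w : nsq (fun k => c k + w * d k) = nsq (fun k => reduce a c k + w * reduce a d k) +
   (1 - cmod a ^+ 2) * cmod (psum c a + w * psum d a) ^+ 2.
  have lw : l2 (fun k => c k + w * d k) by apply: l2D => //; exact: l2Z.
  have := (reduce_nsq lw a1').2; rewrite psum_lin// reduce_lin// => ->.
  by rewrite subrK.
rewrite polar /l2dot !H; simpc; congr Complex; ring.
Qed.

Lemma l2dot0r c : l2dot c (fun=> 0) = 0.
Proof.
rewrite /l2dot; under eq_fun do rewrite mulr0.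
under [X in Complex ((_ - nsq X) / _) _]eq_fun do rewrite mulr0.
under [X in Complex _ ((nsq X - _) / _)]eq_fun do rewrite mulr0.
under [X in Complex _ ((_ - nsq X) / _)]eq_fun do rewrite mulr0.
by rewrite !subrr !mul0r.
Qed.

Lemma nsq0 : nsq (fun=> 0 : C) = 0.
Proof.
apply/eqP; rewrite eq_le nsq_ge0 andbT; apply: nsq_le => n.
by rewrite /series/= big1// => i _; rewrite cmod0 expr0n.
Qed.

Lemma Re_l2dot_self c : l2 c -> complex.Re (l2dot c c) = nsq c.
Proof.
move=> lc; rewrite /l2dot/=.
have -> : (fun k => c k + 1 * c k) = (fun k => (2 : R)%:C * c k).
  have E2 : (2 : R)%:C = 1 + 1 :> C by rewrite -(rmorph1 (real_complex R)) -rmorphD.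
  by apply/funext => k; rewrite E2 mulrDl !mul1r.
have -> : (fun k => c k + -1 * c k) = (fun=> 0).
  by apply/funext => k; rewrite mulN1r subrr.
rewrite nsq0 nsqZ// cmod_real ger0_norm// subr0; by field.
Qed.

(** Coefficients of the normalised Szego kernel at [a]. *)
Definition skern a k : C := (Num.sqrt (1 - cmod a ^+ 2))%:C * conjc a ^+ k.

Lemma one_sub_sqr_gt0 a : cmod a < 1 -> 0 < 1 - cmod a ^+ 2.
Proof. by move=> a1; rewrite subr_gt0 expr_lt1// cmod_ge0. Qed.

Lemma l2_skern a : cmod a < 1 -> l2 (skern a).
Proof.
move=> a1; have s0 := one_sub_sqr_gt0 a1.
apply: (@l2_bound _ _ 1) => n; rewrite /series/=.
apply: (@le_trans _ _ (\sum_(0 <= k < n) (1 - cmod a ^+ 2) * (cmod a ^+ 2) ^+ k)).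
  rewrite ler_sum// => k _; rewrite /skern cmodM cmodX cmodJ exprMn cmod_real.
  by rewrite ger0_norm ?sqrtr_ge0// sqr_sqrtr ?(ltW s0)// -!exprM mulnC.
rewrite -mulr_sumr -ler_pdivlMl// mulr1; apply: geo_le; first exact: sqr_ge0.
by rewrite -subr_gt0.
Qed.

Lemma blaschke_den_neq0 a z : cmod a < 1 -> cmod z < 1 -> 1 - conjc a * z != 0.
Proof.
move=> a1 z1; rewrite -cmod_eq0 gt_eqF// (lt_le_trans _ (cmodB _ _))// cmod1 cmodM cmodJ subr_gt0.
by apply: mulr_ilt1; rewrite ?cmod_ge0.
Qed.

Lemma psum_skern a z : cmod a < 1 -> cmod z < 1 ->
  psum (skern a) z = (Num.sqrt (1 - cmod a ^+ 2))%:C / (1 - conjc a * z).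
Proof.
move=> a1 z1; have lk := l2_skern a1.
have E : (fun k => skern a k.+1) = (fun k => 0 + conjc a * skern a k).
  by apply/funext => k; rewrite /skern [conjc a ^+ _.+1]exprS add0r mulrCA.
have := psum_recl lk z1; rewrite E psum_lin//; last exact: l20.
rewrite psum0 add0r {2}/skern expr0 mulr1 => h.
have nz := blaschke_den_neq0 a1 z1.
apply: (canRL (mulfK nz)).
by rewrite mulrBr mulr1 {1}h; ring.
Qed.

Lemma tail_skern a k : cmod a < 1 ->
  tail (skern a) a k = conjc a ^+ k * psum (skern a) a.
Proof.
move=> a1; rewrite /tail /psum -csumZ; last by apply: summ_l2 => //; exact: l2_skern.
congr csum; apply/funext => j; rewrite /skern exprD; ring.
Qed.

Lemma reduce_skern a : cmod a < 1 -> reduce a (skern a) = (fun=> 0).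
Proof.
move=> a1; apply/funext => k; rewrite reduceE//; last exact: l2_skern.
by rewrite !tail_skern// exprS mulrA subrr.
Qed.

Lemma l2dot_skern c a : l2 c -> cmod a < 1 ->
  l2dot c (skern a) = (Num.sqrt (1 - cmod a ^+ 2))%:C * psum c a.
Proof.
move=> lc a1; have lk := l2_skern a1; have s0 := one_sub_sqr_gt0 a1.
rewrite (l2dot_reduce lc lk a1) reduce_skern// l2dot0r add0r psum_skern//.
have Da : 1 - conjc a * a = (1 - cmod a ^+ 2)%:C by rewrite mulrC mulcJ rmorphB rmorph1.
have E : (1 - cmod a ^+ 2)%:C = (Num.sqrt (1 - cmod a ^+ 2))%:C * (Num.sqrt (1 - cmod a ^+ 2))%:C.
  by rewrite -rmorphM/= -expr2 sqr_sqrtr// ltW.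
have S0 : (Num.sqrt (1 - cmod a ^+ 2))%:C != 0.
  by rewrite -cmod_eq0 cmod_real normr_eq0 gt_eqF// sqrtr_gt0.
rewrite Da E invfM mulVKf// conjc_inv conjc_real.
move: (Num.sqrt _)%:C S0 (psum _ _) => s S0 x.
by field.
Qed.

(** Coefficients of [z d(z) / (1 - conj a z)]. *)
Fixpoint quot a d k : C := if k is k'.+1 then d k' + conjc a * quot a d k' else 0.

(** Coefficients of the product of [d] with the Blaschke factor of [a]. *)
Definition bmul a d k : C := quot a d k - a * quot a d k.+1.

Lemma bmul_series a d n :
  series (fun k => cmod (bmul a d k) ^+ 2) n =
  series (fun k => cmod (d k) ^+ 2) n - (1 - cmod a ^+ 2) * cmod (quot a d n) ^+ 2.
Proof.
elim: n => [|n IH]; first by rewrite /series/= !big_geq// cmod0 expr0n mulr0 subr0.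
rewrite /series/= !big_nat_recr//=; move: IH; rewrite /series/= => ->.
have := reduce_telescope a (quot a d n) (quot a d n.+1).
rewrite -/(bmul a d n) [quot a d n.+1]/= addrK => ->; ring.
Qed.

Lemma l2_bmul a d : cmod a < 1 -> l2 d -> l2 (bmul a d).
Proof.
move=> a1 ld; apply: (@l2_bound _ _ (nsq d)) => n; rewrite bmul_series.
apply: le_trans (nsq_ub n ld); rewrite gerBl.
by rewrite mulr_ge0 ?sqr_ge0// ltW// one_sub_sqr_gt0.
Qed.

Lemma quot_bound a d : cmod a < 1 -> l2 d -> exists B, forall n, cmod (quot a d n) <= B.
Proof.
move=> a1 ld; have s0 := one_sub_sqr_gt0 a1.
exists (Num.sqrt (nsq d / (1 - cmod a ^+ 2))) => n.
rewrite -ler_sqr ?nnegrE ?cmod_ge0 ?sqrtr_ge0// sqr_sqrtr; last first.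
  by rewrite divr_ge0 ?nsq_ge0// ltW.
rewrite ler_pdivlMr// mulrC; apply: le_trans (nsq_ub n ld).
rewrite -subr_ge0 -bmul_series; apply: sumr_ge0 => k _; exact: sqr_ge0.
Qed.

(** The partial sums telescope, with remainder [a^n quot a d (k + n)], and [quot]
is bounded. *)
Lemma tail_bmul a d k : cmod a < 1 -> l2 d -> tail (bmul a d) a k = quot a d k.
Proof.
move=> a1 ld; have [B HB] := quot_bound a1 ld.
apply: csum_unique.
have E n : series (fun j => bmul a d (k + j) * a ^+ j) n = quot a d k - a ^+ n * quot a d (k + n).
  rewrite /series/=; elim: n => [|n IH]; first by rewrite big_geq// addn0 mul1r subrr.
  by rewrite big_nat_recr//= IH /bmul addnS exprS; ring.
have -> : series (fun j => bmul a d (k + j) * a ^+ j) =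
   (fun n => quot a d k - a ^+ n * quot a d (k + n)) by apply/funext => n.
rewrite -[X in _ --> X]subr0; apply: cvgB; first exact: cvg_cst.
apply/cvgC; apply: (@squeeze_cvgr _ _ _ _ (fun=> 0) (fun n => B * cmod a ^+ n)).
- apply: nearW => n; rewrite cmod_ge0 subr0 cmodM cmodX mulrC/=.
  by rewrite ler_wpM2r// exprn_ge0// cmod_ge0.
- exact: cvg_cst.
- rewrite -[X in _ --> X](mulr0 B); apply: cvgMr; apply: cvg_expr.
  by rewrite ger0_norm// cmod_ge0.
Qed.

Lemma psum_bmul_root a d : cmod a < 1 -> l2 d -> psum (bmul a d) a = 0.
Proof. by move=> a1 ld; rewrite -tail0 tail_bmul. Qed.

Lemma reduce_bmul a d : cmod a < 1 -> l2 d -> reduce a (bmul a d) = d.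
Proof.
move=> a1 ld; apply/funext => k; rewrite reduceE//; last exact: l2_bmul.
by rewrite !tail_bmul//= addrK.
Qed.

Lemma nsq_bmul a d : cmod a < 1 -> l2 d -> nsq (bmul a d) = nsq d.
Proof.
move=> a1 ld; have := (reduce_nsq (l2_bmul a1 ld) (ltW a1)).2.
by rewrite reduce_bmul// psum_bmul_root// cmod0 expr0n mulr0 subr0.
Qed.

Lemma l2dot_bmul a c d : cmod a < 1 -> l2 c -> l2 d -> l2dot c (bmul a d) = l2dot (reduce a c) d.
Proof.
move=> a1 lc ld; rewrite (l2dot_reduce lc (l2_bmul a1 ld) a1) reduce_bmul// psum_bmul_root//.
by rewrite conjc0 !mulr0 addr0.
Qed.

Definition blaschke_factor a z : C := (z - a) / (1 - conjc a * z).

Lemma psum_bmul a d z : cmod a < 1 -> cmod z < 1 -> l2 d ->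
  psum (bmul a d) z = blaschke_factor a z * psum d z.
Proof.
move=> a1 z1 ld; have := psum_reduce (l2_bmul a1 ld) a1 z1.
rewrite reduce_bmul// psum_bmul_root// mulr0 addr0 => h.
by rewrite /blaschke_factor mulrAC -h mulrAC divff ?mul1r// blaschke_den_neq0.
Qed.

Lemma psum_step c a z : l2 c -> cmod a < 1 -> cmod z < 1 ->
  psum c z = (Num.sqrt (1 - cmod a ^+ 2))%:C * psum c a *
     ((Num.sqrt (1 - cmod a ^+ 2))%:C / (1 - conjc a * z)) + blaschke_factor a z * psum (reduce a c) z.
Proof.
move=> lc a1 z1; have s0 := one_sub_sqr_gt0 a1.
have nz := blaschke_den_neq0 a1 z1.
have h := psum_reduce lc a1 z1.
have E : (1 - cmod a ^+ 2)%:C = (Num.sqrt (1 - cmod a ^+ 2))%:C * (Num.sqrt (1 - cmod a ^+ 2))%:C.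
  by rewrite -rmorphM/= -expr2 sqr_sqrtr// ltW.
apply: (mulfI nz); rewrite h E /blaschke_factor.
move: (Num.sqrt _)%:C (1 - _ * _) nz (psum _ _) (psum _ _) => s D nz x y.
by field.
Qed.

End Polarisation.

(** * Takenaka-Malmquist functions and best approximation *)

Section Link.
Context {R : realType}.
Local Notation C := R[i].
Implicit Types (a z w : C) (c d : nat -> C) (f : C -> C) (s : seq C).
Local Notation sq a := (Num.sqrt (1 - cmod a ^+ 2))%:C.

Definition blaschke_prod s z : C := \prod_(a <- s) blaschke_factor a z.

Lemma bmul_iter s d : odisc s -> l2 d -> exists d', [/\ l2 d', nsq d' = nsq d &
  forall z, cmod z < 1 -> psum d' z = blaschke_prod s z * psum d z].
Proof.
elim: s => [|a s IH] /=; first by exists d; split=> // z _; rewrite /blaschke_prod big_nil mul1r.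
move=> /andP[a1 s1] ld; have [d' [ld' nd' pd']] := IH s1 ld.
exists (bmul a d'); split; [exact: l2_bmul|by rewrite nsq_bmul|move=> z z1].
by rewrite psum_bmul// pd'// /blaschke_prod big_cons mulrA.
Qed.

Definition pts n (b : 'I_n -> C) : seq C := [seq b i | i <- enum 'I_n].

Lemma size_pts n (b : 'I_n -> C) : size (pts b) = n.
Proof. by rewrite size_map size_enum_ord. Qed.

Lemma odisc_pts n (b : 'I_n -> C) : (forall k, unit_disc (b k)) -> odisc (pts b).
Proof. by move=> H; apply/allP => _ /mapP[i _ ->]; exact: H. Qed.

Lemma pts_recl n (b : 'I_n.+1 -> C) :
  pts b = b ord0 :: pts (fun j => b (lift ord0 j)).
Proof. by rewrite /pts enum_ordSl/= -map_comp. Qed.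

Lemma pts_nth s n : size s = n -> pts (fun i : 'I_n => nth 0 s i) = s.
Proof.
move=> sn; apply: (@eq_from_nth _ 0); rewrite size_pts// => i ilt.
by rewrite (nth_map (Ordinal ilt)) ?size_enum_ord// nth_enum_ord.
Qed.

Lemma TM_ord0 n (b : 'I_n.+1 -> C) z :
  TM b ord0 z = sq (b ord0) / (1 - conjc (b ord0) * z).
Proof. by rewrite /TM big1 ?mulr1. Qed.

Lemma TM_lift n (b : 'I_n.+1 -> C) k z :
  TM b (lift ord0 k) z = blaschke_factor (b ord0) z * TM (fun j => b (lift ord0 j)) k z.
Proof.
rewrite /TM [in LHS]big_mkcond big_ord_recl/= -/(blaschke_factor (b ord0) z).
rewrite [in RHS]big_mkcond/= mulrCA; congr (_ * (_ * _)).
Qed.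

(** [E_{a_1, ..., a_k}] is [b_{a_1}] times [E_{a_2, ..., a_k}], and multiplication
by [b_{a_1}] moves across the inner product as one reduction step at [a_1]. *)
Lemma TM_coefs n (b : 'I_n -> C) (k : 'I_n) : odisc (pts b) ->
  exists d, [/\ l2 d, forall z, unit_disc z -> TM b k z = psum d z &
    forall c, l2 c -> l2dot c d = sq (b k) * psum (reduces (take k (pts b)) c) (b k)].
Proof.
elim: n b k => [|n IH] b k; first by case: k.
rewrite pts_recl /= => /andP[b1 bs].
case: (unliftP ord0 k) => [k' ->|->].
  have [d [ld dz dc]] := IH _ k' bs.
  exists (bmul (b ord0) d); split; first exact: l2_bmul.
    by move=> z z1; rewrite TM_lift dz// psum_bmul.
  move=> c lc; rewrite l2dot_bmul// dc//.
  exact: (reduce_nsq lc (ltW b1)).1.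
exists (skern (b ord0)); split; first exact: l2_skern.
  by move=> z z1; rewrite TM_ord0 psum_skern.
by move=> c lc; rewrite l2dot_skern.
Qed.

Lemma psum_decomp n (b : 'I_n -> C) c z : odisc (pts b) -> l2 c -> cmod z < 1 ->
  psum c z = \sum_(k < n) sq (b k) * psum (reduces (take k (pts b)) c) (b k) * TM b k z +
     blaschke_prod (pts b) z * psum (reduces (pts b) c) z.
Proof.
elim: n b c => [|n IH] b c.
  move=> _ lc z1; rewrite big_ord0 add0r.
  have -> : pts b = [::] by apply/size0nil; rewrite size_pts.
  by rewrite /blaschke_prod big_nil mul1r.
rewrite pts_recl /= => /andP[b1 bs] lc z1.
rewrite big_ord_recl TM_ord0 take0/= {1}(psum_step lc b1 z1) -addrA; congr (_ + _).
have la := (reduce_nsq lc (ltW b1)).1.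
rewrite (IH _ _ bs la z1) mulrDr mulr_sumr /blaschke_prod big_cons -mulrA; congr (_ + _).
by apply: eq_bigr => k _; rewrite TM_lift mulrCA.
Qed.

Section fixed.
Variables (f : C -> C) (c : nat -> C).
Hypotheses (lc : l2 c) (fc : forall z, unit_disc z -> f z = psum c z).

Lemma TM_coefE n (b : 'I_n -> C) k : (forall k, unit_disc (b k)) ->
  TM_coef f b k = sq (b k) * psum (reduces (take k (pts b)) c) (b k).
Proof.
move=> /odisc_pts b1; have [d [ld dz dc]] := TM_coefs k b1.
by rewrite /TM_coef (hip_l2dot lc ld fc dz) dc.
Qed.

Lemma TM_distE n (b : 'I_n -> C) : (forall k, unit_disc (b k)) ->
  TM_dist f b = nrm (reduces (pts b) c).
Proof.
move=> b1; have o1 := odisc_pts b1.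
have lA := reduces_l2 (odisc_cdisc o1) lc.
have [d [ld nd pd]] := bmul_iter o1 lA.
have E z : unit_disc z -> f z - blaschke_form b (TM_coef f b) z = psum d z.
  move=> z1; rewrite fc// pd// (psum_decomp o1 lc z1) /blaschke_form.
  under [X in _ - X]eq_bigr do rewrite TM_coefE//.
  by rewrite addrC addKr.
by rewrite /TM_dist /hnorm (hip_l2dot ld ld E E) Re_l2dot_self// nd.
Qed.

(** If the remainder vanishes, [psum_decomp] writes [f] as a Blaschke form. *)
Lemma not_blaschke_form m : ~ is_blaschke_form m f -> forall s, odisc s -> size s = m ->
  exists k, reduces s c k != 0.
Proof.
move=> nb s s1 sm; apply: contrapT => H; apply: nb.
have A0 : reduces s c = (fun=> 0).
  by apply/funext => k; apply/eqP/negPn/negP => h; apply: H; exists k.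
pose b (i : 'I_m) := nth 0 s i.
have bs : pts b = s by exact: pts_nth.
exists b, (fun k => sq (b k) * psum (reduces (take k (pts b)) c) (b k)); split.
  by move=> k; apply: (allP s1); rewrite mem_nth ?sm.
move=> z z1; rewrite fc// (@psum_decomp m b c z) ?bs//.
by rewrite A0 psum0 mulr0 addr0.
Qed.

End fixed.
End Link.

Theorem theorem1 (R : realType) (f : R[i] -> R[i]) (n : nat)
  (hf : hardy2 f) (hn : (0 < n)%N)
  (hfn : forall m : nat, (m < n)%N -> ~ is_blaschke_form m f) :
  exists a : 'I_n -> R[i],
    [/\ forall k, unit_disc (a k),
        TM_dist f a =
          inf [set TM_dist f b | b in [set b : 'I_n -> R[i] |
                                         forall k, unit_disc (b k)]] &
        nondegenerate_coefs (TM_coef f a)].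
Proof.
have [c [lc fl]] := hf.
have fc z : unit_disc z -> f z = psum c z by move=> /fl h; exact/esym/csum_unique.
case: n hn hfn => // n _ hfn.
have [t [a [tn t1 a1 pa amin]]] := l2_best lc
  (fun t ot tn => not_blaschke_form lc fc (hfn _ tn) ot erefl).
pose s := rcons t a; have sn : size s = n.+1 by rewrite size_rcons tn.
have os : odisc s by rewrite /odisc all_rcons a1.
pose b (i : 'I_n.+1) := nth 0 s i.
have bs : pts b = s by exact: pts_nth.
have b1 k : unit_disc (b k) by apply: (allP os); rewrite mem_nth ?sn.
exists b; split => //.
- set S := [set _ | _ in _].
  have lbS : lbound S (TM_dist f b).
    move=> _ [b' b'1 <-]; rewrite (TM_distE lc fc b1) (TM_distE lc fc b'1) bs.
    rewrite ler_wsqrtr// amin ?size_pts//.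
    by apply: odisc_cdisc; exact: odisc_pts.
  have Sb : S (TM_dist f b) by exists b.
  apply/eqP; rewrite eq_le; apply/andP; split.
    by apply: lb_le_inf => //; exists (TM_dist f b).
  by apply: ge_inf => //; exists (TM_dist f b).
- exists ord_max; split=> //.
  rewrite (TM_coefE lc fc)// bs /b /= /s nth_rcons -tn ltnn eqxx.
  rewrite -cats1 take_size_cat//; apply/eqP; rewrite mulf_neq0//.
  by rewrite -cmod_eq0 cmod_real normr_eq0 gt_eqF// sqrtr_gt0 one_sub_sqr_gt0.
Qed.
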